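(* For any $\alpha\in(0,\frac13)$ there is a probability $F$ on $\mathbb{R}$ which satisfies, for some $A\in RV(\alpha)$ and some $p,q>0$, $\overline F(x)\sim\frac p{A(x)}$ and $F(-x)\sim\frac q{A(x)}$ as $x\to\infty$, such that $\tilde I_1(\delta;x)$ is a.n. but $\tilde I_2(\delta,\eta;x)$ is not a.n., for any $\eta\in(0,1)$ (hence the strong renewal theorem (SRT) fails for $F$).
   Context: $RV(\gamma)$: $f\in RV(\gamma)$ iff $f(x)=x^\gamma\ell(x)$ with $\ell$ slowly varying at infinity. $\overline F(x):=F((x,\infty))$, $F(x):=F((-\infty,x])$; $f\sim g$ means $f/g\to1$. Standing normalization (without loss of generality): $A:[0,\infty)\to(0,\infty)$ is differentiable, strictly increasing, $A'(s)\sim\alpha A(s)/s$, $A(0)=\frac12$, $A(1)=1$; $a_n:=A^{-1}(n)$. $\int F(x+\mathrm{d}y)g(y)$ means $\int g(w-x)F(\mathrm{d}w)$. For $k\ge0$: $b_k(x):=\frac{A(|x|)^k}{|x|\vee1}$, and $\tilde b_k(z,x):=\int_{|x|}^{|z|}\frac{b_k(t)}{t\vee1}\mathrm{d}t$, which is $0$ if $|x|>|z|$. For $\delta>0$, $x\ge0$, $\eta\in(0,1)$: $$\tilde I_1(\delta;x):=\int_{|y|\le\delta x}F(x+\mathrm{d}y)\,\tilde b_2(\delta x,y),$$ $$\tilde I_2(\delta,\eta;x):=\int_{|y_1|\le\delta x}F(x+\mathrm{d}y_1)\int_{|y_2|\le\eta|y_1|}F(-y_1+\mathrm{d}y_2)\,\tilde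 b_3(y_1,y_2).$$ $J(\delta;x)$ is a.n. if $\lim_{\delta\to0}\limsup_{x\to+\infty}\frac{J(\delta;x)}{A(x)/x}=0$. $F$ is arithmetic if supported by $h\mathbb{Z}$ for some $h>0$; the maximal such $h$ is its arithmetic span. Let $h$ be the arithmetic span of $F$ if $F$ is arithmetic and any fixed positive number otherwise. Let $S_0=0$, $S_n=X_1+\dots+X_n$ with $X_i$ i.i.d. of law $F$; $S_n/a_n$ converges in law to a stable random variable $Y$ of index $\alpha$. $U(\mathrm{d}x):=\sum_{n\ge0}\mathbb{P}(S_n\in\mathrm{d}x)$. The SRT is the relation $U((x-h,x])\sim\mathsf{C}\,h\,\frac{A(x)}{x}$ as $x\to\infty$, with $\mathsf{C}:=\alpha\,\mathbb{E}[Y^{-\alpha}\mathbf{1}_{\{Y>0\}}]$. *)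

(* Defs.v *)
From HB Require Import structures.
From mathcomp Require Import all_boot all_order all_algebra.
From mathcomp Require Import all_classical all_reals all_analysis.

Set Implicit Arguments.
Unset Strict Implicit.
Unset Printing Implicit Defensive.

Import Order.TTheory GRing.Theory Num.Theory.
Import numFieldNormedType.Exports.

Local Open Scope classical_set_scope.
Local Open Scope ring_scope.

Section asymptotics.
Context {R : realType}.

Definition asymp_equiv (f g : R -> R) : Prop :=
  f x / g x @[x --> +oo] --> (1 : R).

Definition slowly_varying (l : R -> R) : Prop :=
  [/\ measurable_fun (`]0, +oo[ : set R) l,
      \forall x \near +oo, 0 < l x
    & forall c : R, 0 < c -> asymp_equiv (fun x => l (c * x)) l].

Definition RV (gamma : R) (f : R -> R) : Prop :=
  exists2 l : R -> R, slowly_varying l &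
    forall x, 0 < x -> f x = x `^ gamma * l x.

(* Functions on [0, oo) are represented by functions on R, only their values on
   [0, oo) being relevant; in particular the derivative at 0 is one-sided. *)
Definition standard_normalization (alpha : R) (A : R -> R) : Prop :=
  [/\ forall x, 0 <= x -> 0 < A x,
      forall x y, 0 <= x -> x < y -> A x < A y,
      (forall x, 0 < x -> derivable A x 1) /\
        cvg ((A t - A 0) / t @[t --> (0:R)^'+]),
      asymp_equiv (derive1 A) (fun s => alpha * A s / s)
    & A 0 = 2^-1 /\ A 1 = 1].

(* The solution [s] is unique for [A] strictly increasing, and exists for t >= 1/2 when [A]
   is moreover continuous and unbounded. *)
Definition inv_of (A : R -> R) (t : R) : R :=
  xget 0 [set s | 0 <= s /\ A s = t].

(* [J delta x] is asymptotically negligible. *)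
Definition is_an (A : R -> R) (J : R -> R -> \bar R) : Prop :=
  limf_esup (fun x => J delta x * ((A x / x)^-1)%:E)%E (pinfty_nbhs R)
    @[delta --> 0^'+] --> 0%E.

End asymptotics.

Section integrals.
Context {R : realType}.
Implicit Types (A : R -> R) (F : probability (measurableTypeR R) R).

Definition b_ A (k : nat) (x : R) : R := A `|x| ^+ k / Num.max `|x| 1.

(* The interval is empty, hence the integral is 0, if |x| > |z|. *)
Definition btilde A (k : nat) (z x : R) : \bar R :=
  (\int[lebesgue_measure]_(t in `[`|x|%R, `|z|%R]) (b_ A k t / Num.max t 1)%:E)%E.

(* Integral of [g y] over [y] in [D] against F(x + dy). *)
Definition shift_integral F (x : R) (D : set R) (g : R -> \bar R) : \bar R :=
  (\int[F]_(w in [set w | D (w - x)%R]) g (w - x)%R)%E.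

Definition I1tilde A F (delta x : R) : \bar R :=
  shift_integral F x [set y | `|y| <= delta * x]
    (fun y => btilde A 2 (delta * x) y).

Definition I2tilde A F (eta delta x : R) : \bar R :=
  shift_integral F x [set y1 | `|y1| <= delta * x] (fun y1 =>
    shift_integral F (- y1) [set y2 | `|y2| <= eta * `|y1|]
      (fun y2 => btilde A 3 y1 y2)).

End integrals.

Section random_walk.
Context {R : realType}.
Notation TR := (measurableTypeR R).
Implicit Types (A : R -> R) (F nu : probability TR R).

Definition lattice (h : R) : set R := [set k%:~R * h | k in [set: int]].

Definition supported_by_lattice F (h : R) : Prop := F (lattice h) = 1%E.

Definition arithmetic_law F : Prop :=
  exists2 h : R, 0 < h & supported_by_lattice F h.

Definition arithmetic_span F (h : R) : Prop :=
  [/\ 0 < h, supported_by_lattice F h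
    & forall h', 0 < h' -> supported_by_lattice F h' -> h' <= h].

Definition admissible_span F (h : R) : Prop :=
  0 < h /\ (arithmetic_law F -> arithmetic_span F h).

Definition sum_pair (z : TR * TR) : TR := z.1 + z.2.

Lemma measurable_sum_pair : measurable_fun [set: TR * TR] sum_pair.
Proof.
exact: (measurable_realfun.measurable_funD measurable_fst measurable_snd).
Qed.

HB.instance Definition _ :=
  isMeasurableFun.Build _ _ _ _ sum_pair measurable_sum_pair.

(* The law of S_n, i.e. the n-fold convolution of F: S_(n+1) is the sum of the
   two coordinates under (law of S_n) x F, which makes them independent. *)
Fixpoint walk_law F (n : nat) : probability TR R :=
  if n is m.+1 then distribution (walk_law F m \x F)%E sum_pair else \d_(0 : TR).

Definition renewal_measure F (B : set R) : \bar R :=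
  (\sum_(n <oo) walk_law F n B)%E.

(* S_n / a_n converges in law to a random variable of law nu. Such a nu is
   unique, and under tail conditions of index alpha it is the stable law of
   index alpha. *)
Definition walk_cvg_law F (a : R^nat) nu : Prop :=
  forall f : R -> R, continuous f -> (exists M, forall x, `|f x| <= M) ->
    (\int[walk_law F n]_s f (s / a n)) @[n --> \oo] --> \int[nu]_y f y.

(* alpha E[Y^(-alpha) 1_(Y > 0)] for Y of law nu; the expectation is finite when
   nu is stable, as its density is bounded near 0. *)
Definition srt_constant (alpha : R) nu : R :=
  alpha * \int[nu]_(y in `]0, +oo[) (y `^ (- alpha)).

Definition SRT (alpha : R) A F nu (h : R) : Prop :=
  (renewal_measure F `](x - h)%R, x] *
     ((srt_constant alpha nu * h * (A x / x))^-1)%:E)%E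
    @[x --> +oo] --> 1%E.

End random_walk.

(* Main.v *)
(* With theta = 2^alpha and n = floor (log_4 N), the law F lives on the integers and has
   exactly regular tails c / A up to two negligible perturbations:
   - clusters to the right of 2^N: for each of the last 2^(n+1) scales j < N, the
     points within 2^(j-3n) of 2^N + 3 * 2^(j-1) get density
     (theta/2)^N theta^(-2(j-3n)) / (n+1);
   - spikes: the single points - 3 * 2^(j-1) get mass theta^(-j) / (floor (log_4 j) + 1).
   A cluster contributes O(1/(n+1)) A(x)/x to I1tilde at its own centre, where the
   kernel |y|^(2 alpha - 1) has mass theta^(2(j-3n)), and the clusters far from x
   contribute little in total because theta^6 < 4. A jump into the cluster of
   scale j followed by the spike jump of scale j ends within 2^(j-3n) of 2^N,
   where the third order kernel yields a contribution of order
   theta^(-3n) / (n+1)^2 A(x)/x for every one of the 2^n scales. Since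
   theta^3 < 2 for alpha < 1/3, the sum (2/theta^3)^n / (n+1)^2 is unbounded.
   The same pairs of jumps, surrounded by about A(2^(j-3n)) steps of smaller size, give
   U({x}) x / A(x) -> oo along x = 2^(4^n), which refutes the strong renewal
   theorem whatever the value of the constant. *)
Require Import Defs.
From mathcomp Require Import all_boot all_order all_algebra.
From mathcomp Require Import all_classical all_reals all_analysis measurable_realfun.
From mathcomp Require Import zify ring lra.

Set Implicit Arguments.
Unset Strict Implicit.
Unset Printing Implicit Defensive.

Import Order.TTheory GRing.Theory Num.Theory.
Import numFieldNormedType.Exports.

Local Open Scope classical_set_scope.
Local Open Scope ring_scope.

(** * Dyadic sums and the two perturbations *)

(** The 3 in the radius 2^(j-3n) balances two demands. With radius 2^(j-kn), a point near one
    cluster feels each of the other clusters, at most 2^(n+1) of them, with relative weight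
    (theta^2/2)^(kn). This is harmless in total if 2 (theta^2/2)^k <= 1. The second integral gains
    (2/theta^k)^n up to polynomial factors, so theta^k < 2 is wanted as well. For k = 3 both demands
    follow from theta^3 < 2, and no other k meets both for all alpha < 1/3. Base 4 makes 2^n of
    order sqrt N. At N = 4^n the scales between N - 2^(n+1) and N - 2^n are numerous, yet so far
    below N that the first jump is shorter than delta x for every fixed delta. The factors 1/(n+1)
    make the perturbations negligible for the tails and for the first integral, and cost only a
    polynomial factor against an exponential gain. For the renewal measure, three runs of small
    steps (before, between and after the two jumps) have about theta^(j-3n) possible lengths each.
    Their product theta^(3(j-3n)) is also what the third order kernel and the number of sites
    produce together, so both failures rest on the same quantity per scale. *)

Section sums.
Context {R : realType}.
Implicit Types (f : nat -> R) (q : R).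

Lemma dyadic_sum f N :
  \sum_(1 <= k < (2 ^ N)%N) f k = \sum_(j < N) \sum_(s < (2 ^ j)%N) f (2 ^ j + s)%N.
Proof.
elim: N => [|N IH]; first by rewrite expn0 big_geq// big_ord0.
rewrite (@big_cat_nat _ _ _ (2 ^ N)%N)/= ?expn_gt0// ?leq_exp2l// IH big_ord_recr/=.
congr (_ + _).
rewrite -{1}[(2 ^ N)%N]add0n big_addn expnS mul2n -addnn addnK big_mkord.
by apply: eq_bigr => i _; rewrite addnC.
Qed.

Lemma geom_sum_gt1 q n : 1 < q -> \sum_(i < n) q ^+ i <= q ^+ n / (q - 1).
Proof.
move=> q1; rewrite ler_pdivlMr ?subr_gt0// mulrC -subrX1.
by rewrite lerBlDr lerDl.
Qed.

Lemma geom_sum_lt1 q m n : 0 <= q < 1 ->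
  \sum_(m <= i < n) q ^+ i <= q ^+ m / (1 - q).
Proof.
move=> /andP[q0 q1].
have q1' : 0 < 1 - q by rewrite subr_gt0.
have [nm|mn] := leqP n m; first by rewrite big_geq// divr_ge0 ?exprn_ge0// ltW.
rewrite -{1}[m]add0n big_addn big_mkord.
under eq_bigr do rewrite exprD.
rewrite -mulr_suml [leLHS]mulrC ler_wpM2l ?exprn_ge0//.
rewrite -[leRHS]mul1r ler_pdivlMr// mulrC -opprB mulNr -subrX1 opprB.
by rewrite lerBlDr lerDl exprn_ge0.
Qed.

(* Among unimodal profiles sampled at M consecutive integers, each side of the
   peak contributes at most the M largest values. *)
Lemma sum_shift_le (phi : R -> R) (y : R) (M : nat) :
  (forall u, 0 <= phi u) ->
  (forall u v, `|u| <= `|v| -> phi v <= phi u) ->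
  \sum_(i < M) phi (i%:R - y) <= 2 * \sum_(l < M) phi l%:R.
Proof.
move=> phi0 phid.
have [y0|y0] := leP 0 y; last first.
  rewrite mulr_natl mulr2n; apply: ler_wpDl; first exact: sumr_ge0.
  apply: ler_sum => i _; apply: phid; rewrite ger0_norm//.
  have i0 : 0 <= i%:R :> R by [].
  by rewrite ger0_norm; lra.
pose q := Num.truncn y.
have /andP[qy yq] : q%:R <= y < q.+1%:R by rewrite truncn_itv.
pose g1 i := if (i <= q)%N then phi (q - i)%:R else 0.
pose g2 i := if (q < i)%N then phi (i - q.+1)%:R else 0.
have H (i : nat) : phi (i%:R - y) <= g1 i + g2 i.
  rewrite /g1 /g2 ltnNge; case: leqP => iq /=.
    rewrite addr0; apply: phid; rewrite natrB// ger0_norm ?subr_ge0 ?ler_nat//.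
    have : i%:R <= q%:R :> R by rewrite ler_nat.
    by move=> ?; rewrite ler0_norm; lra.
  rewrite add0r; apply: phid; rewrite natrB// ger0_norm ?subr_ge0 ?ler_nat//.
  have : q.+1%:R <= i%:R :> R by rewrite ler_nat.
  by move=> ?; rewrite ger0_norm; lra.
apply: (@le_trans _ _ (\sum_(i < M) (g1 i + g2 i))); first by apply: ler_sum.
rewrite big_split/= mulr_natl mulr2n lerD//.
- have [qM|Mq] := ltnP q M.
    rewrite -(subnKC qM) !big_split_ord/= [X in _ + X]big1 ?addr0; last first.
      by move=> i _; rewrite /g1 leqNgt ltnS leq_addr.
    apply: ler_wpDr; first exact: sumr_ge0.
    rewrite (reindex_inj rev_ord_inj)/=.
    apply: ler_sum => i _; rewrite /g1 subSS leq_subr subKn// -ltnS; exact: ltn_ord.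
  rewrite [leRHS](reindex_inj rev_ord_inj)/=.
  apply: ler_sum => i _; rewrite /g1 (leq_trans _ Mq) 1?ltnW//.
  apply: phid; rewrite !ger0_norm// ler_nat.
  by have := ltn_ord i; lia.
- have [qM|Mq] := ltnP q M; last first.
    rewrite [leLHS]big1 ?sumr_ge0// => i _.
    by rewrite /g2 ltnNge (leq_trans (ltnW (ltn_ord i)) Mq).
  rewrite -(big_mkord xpredT g2) (@big_cat_nat _ _ _ q.+1)//= big_nat_cond big1 ?add0r; last first.
    by move=> i /andP[/andP[_ iq] _]; rewrite /g2 ltnNge -ltnS iq.
  rewrite -{1}[q.+1]add0n big_addn big_mkord.
  rewrite -(big_mkord xpredT (fun i => phi i%:R)) (@big_cat_nat _ _ _ (M - q.+1))/= ?leq_subr//.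
  rewrite big_mkord; apply: ler_wpDr; first exact: sumr_ge0.
  by apply: ler_sum => i _; rewrite /g2 leq_addl addnK.
Qed.
End sums.

Section weights.
Context {R : realType} (theta : R).
Hypothesis theta_gt1 : 1 < theta.
Hypothesis theta3_lt2 : theta ^+ 3 < 2.

(** [N] is already the binary logarithm of a position, so [eps N] decays like the inverse of an
    iterated logarithm of 2^N. *)
Definition lev (N : nat) := trunc_log 4 N.
Definition eps N : R := (lev N).+1%:R^-1.

(* [cluster] lives on the integers 2^N + 2^j + s with |s - 2^(j-1)| < 2^(j-3n),
   n = lev N, and [spike] on the integers 3 * 2^(j-1) = 2^j + 2^(j-1). *)
Definition cluster_window (N j s : nat) : bool :=
  let n := lev N in let K := (2 ^ (j - 3 * n))%N in
  [&& 0 < n, N <= j + 2 ^ n.+1, 3 * n <= j,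
      2 ^ j < s.*2 + K.*2 & s.*2 < 2 ^ j + K.*2]%N.

Definition cluster_weight (N j s : nat) : R :=
  if cluster_window N j s
  then eps N * (theta / 2) ^+ N * theta ^- (2 * (j - 3 * lev N)) else 0.

Definition cluster (k : nat) : R :=
  let N := trunc_log 2 k in let r := (k - 2 ^ N)%N in
  let j := trunc_log 2 r in cluster_weight N j (r - 2 ^ j).

Definition spike (k : nat) : R :=
  let j := trunc_log 2 k in
  if (k - 2 ^ j).*2 == (2 ^ j)%N then eps j * theta ^- j else 0.

Let theta0 : 0 < theta. Proof. exact: lt_trans theta_gt1. Qed.

Lemma eps_gt0 N : 0 < eps N. Proof. by rewrite invr_gt0. Qed.

Lemma eps_ge0 N : 0 <= eps N. Proof. exact/ltW/eps_gt0. Qed.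

Lemma eps_le1 N : eps N <= 1. Proof. by rewrite invf_le1// ler1n. Qed.

Lemma eps_anti N M : (N <= M)%N -> eps M <= eps N.
Proof. by move=> NM; rewrite lef_pV2 ?posrE// ler_nat ltnS leq_trunc_log. Qed.

Lemma eps_theta_ge0 N : 0 <= eps N * (theta / 2) ^+ N.
Proof. by rewrite mulr_ge0 ?eps_ge0// exprn_ge0// divr_ge0// ltW. Qed.

Lemma theta_lt2 : theta < 2.
Proof.
rewrite ltNge; apply/negP => t2; have := theta3_lt2; apply/negP; rewrite -leNgt.
rewrite !exprS expr0 mulr1; nra.
Qed.

Lemma cluster_ge0 k : 0 <= cluster k.
Proof.
rewrite /cluster /cluster_weight; case: ifP => // _.
by rewrite !mulr_ge0 ?invr_ge0 ?exprn_ge0 ?divr_ge0// ltW.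
Qed.

Lemma spike_ge0 k : 0 <= spike k.
Proof.
rewrite /spike; case: ifP => // _.
by rewrite mulr_ge0 ?invr_ge0 ?exprn_ge0// ltW.
Qed.

Lemma trunc_log_add N r : (r < 2 ^ N)%N -> trunc_log 2 (2 ^ N + r) = N.
Proof.
by move=> rN; apply: trunc_log_eq => //; rewrite leq_addr/= expnS mul2n -addnn ltn_add2l.
Qed.

Lemma clusterE N j s : (s < 2 ^ j)%N -> (j < N)%N ->
  cluster (2 ^ N + (2 ^ j + s)) = cluster_weight N j s.
Proof.
move=> sj jN; rewrite /cluster trunc_log_add; last first.
  apply: (@leq_trans (2 ^ j.+1)); last by rewrite leq_exp2l.
  by rewrite expnS mul2n -addnn ltn_add2l.
by rewrite addKn trunc_log_add// addKn.
Qed.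

Lemma cluster_pow2 N : cluster (2 ^ N) = 0.
Proof.
rewrite /cluster trunc_expnK// subnn trunc_log0 /cluster_weight /cluster_window.
case: (lev N) => [|n] //.
case: ifP => //; rewrite mulnS; lia.
Qed.

Lemma spikeE j s : (s < 2 ^ j)%N ->
  spike (2 ^ j + s) = if s.*2 == (2 ^ j)%N then eps j * theta ^- j else 0.
Proof. by move=> sj; rewrite /spike trunc_log_add// addKn. Qed.

Lemma spike_block j : \sum_(s < (2 ^ j)%N) spike (2 ^ j + s)%N <= eps j * theta ^- j.
Proof.
have e0 : 0 <= eps j * theta ^- j by rewrite mulr_ge0 ?invr_ge0 ?exprn_ge0// ltW.
case: j e0 => [|j] e0; first rewrite big1// => s _.
  by rewrite spikeE//; case: eqP => // sE; have := odd_double s; rewrite sE.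
have jlt : (2 ^ j < 2 ^ j.+1)%N by rewrite ltn_exp2l.
rewrite (bigD1 (Ordinal jlt))//= big1 ?addr0; last first.
  move=> s sj; rewrite spikeE//; case: eqP => // s2; exfalso; move/negP: sj; apply.
  apply/eqP/val_inj => /=; apply: double_inj.
  by rewrite s2 expnS mul2n.
by rewrite spikeE// expnS mul2n eqxx.
Qed.

(** * Cluster sums against an abstract decreasing kernel *)

Section kernel.
Variable phi : R -> R.
Hypothesis phi_ge0 : forall u, 0 <= phi u.
Hypothesis phi_anti : forall u v, `|u| <= `|v| -> phi v <= phi u.
Let rho := theta ^+ 2 / 2.
Hypothesis phi_pow2 : forall i, phi (2 ^ i)%:R = rho ^+ i.

Let rho0 : 0 < rho. Proof. by rewrite divr_gt0// exprn_gt0. Qed.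

Let C1 := phi 0 + (theta ^+ 2 - 1)^-1.

Let theta2_gt1 : 1 < theta ^+ 2.
Proof. by rewrite exprn_egt1. Qed.

Let C1_ge0 : 0 <= C1.
Proof. by rewrite addr_ge0// invr_ge0 subr_ge0 ltW. Qed.

(** The dyadic block of index j has 2^j terms, each at most rho^j, and 2 rho = theta^2 > 1: the last
    block dominates the geometric sum. *)
Lemma sum_phi_pow2 i : \sum_(l < (2 ^ i)%N) phi l%:R <= C1 * theta ^+ (2 * i).
Proof.
rewrite -(big_mkord xpredT (fun l => phi l%:R)) big_ltn ?expn_gt0//.
rewrite (dyadic_sum (fun l => phi l%:R)) mulrDl lerD//.
  by rewrite ler_peMr// exprn_ege1// ltW.
apply: (@le_trans _ _ (\sum_(j < i) (theta ^+ 2) ^+ j)); last first.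
  by rewrite exprM mulrC; exact: geom_sum_gt1.
apply: ler_sum => j _.
apply: (@le_trans _ _ (\sum_(s < (2 ^ j)%N) rho ^+ j)).
  apply: ler_sum => s _; rewrite -phi_pow2; apply: phi_anti.
  by rewrite !ger0_norm// ler_nat leq_addr.
rewrite sumr_const card_ord -mulr_natl natrX -exprMn /rho mulrCA divff ?mulr1//.
Qed.

Lemma window_range (j i s : nat) : (0 < j)%N -> (i < j)%N ->
  (2 ^ j < s.*2 + (2 ^ i).*2)%N && (s.*2 < 2 ^ j + (2 ^ i).*2)%N ->
  (2 ^ j.-1 - 2 ^ i <= s < 2 ^ j.-1 - 2 ^ i + 2 ^ i.+1)%N.
Proof.
case: j => // j _ ij.
have := leq_pexp2l (ltn0Sn 1) (ij : (i <= j)%N).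
rewrite /= !expnS !mul2n; lia.
Qed.

Lemma sum_window_le (j i : nat) (g : nat -> R) : (i < j)%N ->
  (forall s, 0 <= g s) ->
  \sum_(s < (2 ^ j)%N | (2 ^ j < s.*2 + (2 ^ i).*2)%N && (s.*2 < 2 ^ j + (2 ^ i).*2)%N) g s
  <= \sum_(l < (2 ^ i.+1)%N) g (2 ^ j.-1 - 2 ^ i + l)%N.
Proof.
move=> ij g0; have j0 : (0 < j)%N by exact: leq_ltn_trans ij.
pose P s := ((2 ^ j < s.*2 + (2 ^ i).*2) && (s.*2 < 2 ^ j + (2 ^ i).*2))%N.
set lo := (2 ^ j.-1 - 2 ^ i)%N.
have hi : (lo + 2 ^ i.+1 <= 2 ^ j)%N.
  rewrite /lo; case: j j0 ij {P lo} => //= j _ ij.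
  have := leq_pexp2l (ltn0Sn 1) (ij : (i <= j)%N).
  rewrite /= !expnS; lia.
rewrite -(big_mkord P g) big_mkcond/=.
rewrite (@big_cat_nat _ _ _ lo)/= ?(leq_trans _ hi) ?leq_addr//.
rewrite (@big_cat_nat _ _ _ (lo + 2 ^ i.+1) lo)/= ?leq_addr//.
rewrite big_nat big1 ?add0r; last first.
  move=> s /= slo; case: ifPn => // /(window_range j0 ij) /andP[].
  by rewrite -/lo; lia.
rewrite [X in _ + X <= _]big_nat [X in _ + X <= _]big1 ?addr0; last first.
  move=> s /= slo; case: ifPn => // /(window_range j0 ij) /andP[].
  by rewrite -/lo; lia.
rewrite -{1}[lo]add0n big_addn addKn big_mkord.
apply: ler_sum => l _; rewrite addnC; by case: ifP.
Qed.

Lemma rhoXV i : theta ^- (2 * i) * (2 ^+ i) = rho ^- i.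
Proof.
rewrite /rho expr_div_n invf_div -exprM mulrC; congr (_ / _).
Qed.

Let C2 := 4 * C1 * theta ^+ 2.
Let C3 := 2 * rho ^- 2.

Let C2_ge0 : 0 <= C2.
Proof. by apply: mulr_ge0; [exact: mulr_ge0|exact/exprn_ge0/ltW]. Qed.

Let C3_ge0 : 0 <= C3.
Proof. by apply: mulr_ge0 => //; rewrite invr_ge0 exprn_ge0 ?ltW. Qed.

(** Put i = j - 3n. If [y] lies in the dyadic block of the cluster, the kernel mass theta^(2i)
    cancels the density theta^(-2i) and leaves a constant. Otherwise [y] is at distance at least
    2^(j-2) from every cluster point, and 2^(i+1) points of weight theta^(-2i) rho^(j-2) give 2
    rho^(-2) rho^(3n), because theta^(-2i) 2^i = rho^(-i). *)
Lemma cluster_weight_sum N j y : (j < N)%N ->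
  \sum_(s < (2 ^ j)%N) cluster_weight N j s * phi ((2 ^ j + s)%:R - y)
  <= eps N * (theta / 2) ^+ N *
     ((j == trunc_log 2 (Num.truncn y))%:R * C2
      + (N <= j + 2 ^ (lev N).+1)%:R * (C3 * rho ^+ (3 * lev N))).
Proof.
move=> jN; set kap := eps N * _; set n := lev N.
have kap0 : 0 <= kap by rewrite mulr_ge0 ?eps_ge0// exprn_ge0// divr_ge0// ltW.
have C30 : 0 <= C3 * rho ^+ (3 * n).
  by apply: mulr_ge0 => //; exact/exprn_ge0/ltW.
have [/and3P[n0 Nj nj]|no] := boolP [&& 0 < n, N <= j + 2 ^ n.+1 & 3 * n <= j]%N; last first.
  rewrite big1 => [|s _].
    by apply: mulr_ge0 => //; apply: addr_ge0; exact: mulr_ge0.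
  rewrite /cluster_weight /cluster_window -/n; move: no.
  by case: (0 < n)%N => //=; case: (N <= _)%N => //=; case: (3 * n <= j)%N => //=; rewrite mul0r.
rewrite Nj mul1r.
set i := (j - 3 * n)%N.
have ij : (i.+2 < j)%N by rewrite /i; move: (n0) (nj); clear; lia.
pose P (s : nat) := ((2 ^ j < s.*2 + (2 ^ i).*2) && (s.*2 < 2 ^ j + (2 ^ i).*2))%N.
have -> : \sum_(s < (2 ^ j)%N) cluster_weight N j s * phi ((2 ^ j + s)%:R - y) =
  kap * (theta ^- (2 * i) * \sum_(s < (2 ^ j)%N | P s) phi ((2 ^ j + s)%:R - y)).
  rewrite mulrA mulr_sumr [RHS]big_mkcond/=; apply: eq_bigr => s _.
  rewrite /cluster_weight /cluster_window -/n n0 Nj nj/= -/i -/(P s).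
  by case: ifP => //; rewrite mul0r.
rewrite ler_wpM2l//.
have t2i : 0 < theta ^+ (2 * i) by rewrite exprn_gt0.
have ij1 : (i < j)%N by move: ij; clear; lia.
case: eqP => [_|jy].
  rewrite mul1r; apply: ler_wpDr => //.
  rewrite mulrC ler_pdivrMr//.
  apply: le_trans.
    by apply: (@sum_window_le j i (fun s => phi ((2 ^ j + s)%:R - y))).
  set lo := (2 ^ j.-1 - _)%N.
  have -> : \sum_(l < (2 ^ i.+1)%N) phi ((2 ^ j + (lo + l))%:R - y) =
            \sum_(l < (2 ^ i.+1)%N) phi (l%:R - (y - (2 ^ j + lo)%:R)).
    apply: eq_bigr => l _; congr phi; rewrite !natrD; ring.
  apply: le_trans; first exact: sum_shift_le.
  apply: (@le_trans _ _ (2 * (C1 * theta ^+ (2 * i.+1)))).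
    by apply: ler_wpM2l => //; exact: sum_phi_pow2.
  have := mulr_ge0 C2_ge0 (ltW t2i).
  rewrite mulnS exprD /C2; lra.
rewrite mul0r add0r.
have -> : C3 * rho ^+ (3 * n) = theta ^- (2 * i) * (2 ^+ i.+1 * rho ^+ j.-2).
  have rho_neq0 k : rho ^+ k != 0 by rewrite expf_neq0// gt_eqF.
  have -> : rho ^+ j.-2 = rho ^- 2 * (rho ^+ i * rho ^+ (3 * n)).
    apply: (mulfI (rho_neq0 2)); rewrite mulVKf// -!exprD; congr (_ ^+ _).
    by rewrite /i; move: ij nj; rewrite /i; clear; lia.
  transitivity (C3 * ((theta ^- (2 * i) * 2 ^+ i) * (rho ^+ i * rho ^+ (3 * n)))).
    by rewrite rhoXV mulKf.
  rewrite /C3 [2 ^+ i.+1]exprS.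
  by move: (theta ^- _) (2 ^+ i) (rho ^- 2) (rho ^+ i) (rho ^+ _) => *; ring.
apply: ler_wpM2l; first by rewrite invr_ge0 ltW.
apply: (@le_trans _ _ (\sum_(s < (2 ^ j)%N | P s) rho ^+ j.-2)).
  apply: ler_sum => s /andP[s1 s2]; rewrite -phi_pow2; apply: phi_anti.
  move: (nat_of_ord s) s1 s2 => {}s s1 s2.
  (* In units of 2^j', the block of index j is [8, 16) and the cluster lies in [11, 13]; a [y]
     outside the block is thus at distance at least 3 units, more than the 2 units of 2^(j-2). *)
  have [j' jE] : exists j', j = j'.+3 by exists (j - 3)%N; move: ij; clear; lia.
  have ij' : (2 ^ i <= 2 ^ j')%N by rewrite leq_exp2l//; move: ij; rewrite jE; clear; lia.
  have s3 : (3 * 2 ^ j' < s)%N by move: s1 ij'; rewrite jE !expnS; clear; lia.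
  have s5 : (s < 5 * 2 ^ j')%N by move: s2 ij'; rewrite jE !expnS; clear; lia.
  have {s3}s3 : 3 * 2 ^+ j' <= s%:R :> R by rewrite -natrX -natrM ler_nat ltnW.
  have {s5}s5 : s%:R <= 5 * 2 ^+ j' :> R by rewrite -natrX -natrM ler_nat ltnW.
  rewrite natrD jE /= !natrX !exprS; have p0 : 0 < 2 ^+ j' :> R by rewrite exprn_gt0.
  have [y8|y8] := ltP y (8 * 2 ^+ j').
    by rewrite !ger0_norm; lra.
  have [y16|y16] := ltP y (16 * 2 ^+ j'); last first.
    by rewrite ger0_norm ?ler0_norm; lra.
  exfalso; apply: jy; apply/esym/trunc_log_eq => //.
  have y0 : 0 <= y by apply: le_trans y8; rewrite mulr_ge0// ltW.
  rewrite truncn_ge_nat// truncn_lt_nat// jE.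
  have E k : (2 ^ k)%:R = 2 ^+ k :> R by exact: natrX.
  rewrite !E !exprS.
  by apply/andP; split; lra.
apply: le_trans; first by apply: (sum_window_le ij1 (g := fun=> _)) => _; rewrite exprn_ge0// ltW.
by rewrite sumr_const card_ord -[leLHS]mulr_natl natrX.
Qed.

(** Uniformity in [y] is the point: at most one cluster of the block is resonant with [y], and all
    the others together cost a bounded multiple of the same quantity. The first integral needs
    arbitrary [y]; the mass of the block needs [y] = 0. *)
Lemma cluster_block_kernel : exists2 C : R, 0 < C & forall N (y : R),
  \sum_(r < (2 ^ N)%N) cluster (2 ^ N + r)%N * phi (r%:R - y)
  <= C * (eps N * (theta / 2) ^+ N).
Proof.
exists (C2 + C3 * 2) => [|N y].
  have : 0 <= C1 * theta ^+ 2 by rewrite mulr_ge0// exprn_ge0// ltW.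
  have : 0 < rho ^- 2 by rewrite invr_gt0 exprn_gt0.
  by rewrite /C2 /C3; lra.
pose f r := cluster (2 ^ N + r)%N * phi (r%:R - y).
rewrite -(big_mkord xpredT f) big_ltn ?expn_gt0// /f addn0 cluster_pow2 mul0r add0r.
rewrite (dyadic_sum f) /f.
pose g (j : nat) := eps N * (theta / 2) ^+ N *
     ((j == trunc_log 2 (Num.truncn y))%:R * C2
      + (N <= j + 2 ^ (lev N).+1)%:R * (C3 * rho ^+ (3 * lev N))).
apply: (@le_trans _ _ (\sum_(j < N) g j)).
  apply: ler_sum => j _; apply: le_trans (cluster_weight_sum y (ltn_ord j)).
  by apply: ler_sum => s _; rewrite clusterE.
rewrite -mulr_sumr mulrC ler_wpM2r//.
  by rewrite mulr_ge0 ?eps_ge0// exprn_ge0// divr_ge0// ltW.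
rewrite big_split/= lerD// -mulr_suml.
  rewrite ler_piMl// -natr_sum lern1.
  set j0 := trunc_log 2 _; have [j0N|Nj0] := ltnP j0 N.
    rewrite (bigD1 (Ordinal j0N))//= eqxx big1 ?addn0// => j /eqP jj0.
    by case: eqP => // jE; case: jj0; apply: val_inj.
  by rewrite big1// => j _; case: eqP => // jE; move: Nj0; rewrite -jE leqNgt ltn_ord.
rewrite mulrCA ler_wpM2l//.
apply: (@le_trans _ _ (2 ^+ (lev N).+1 * rho ^+ (3 * lev N))).
  rewrite ler_wpM2r ?exprn_ge0 ?(ltW rho0)// -natr_sum -natrX ler_nat.
  move: (2 ^ (lev N).+1)%N => m; rewrite (reindex_inj rev_ord_inj)/=.
  apply: (@leq_trans (\sum_(j < N) (j < m))).
    by apply: leq_sum => j _; have := ltn_ord j; clear; lia.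
  have -> : (\sum_(j < N) (j < m) = minn N m)%N.
    elim: N {y f g} => [|N IH]; first by rewrite big_ord0 min0n.
    by rewrite big_ord_recr/= IH; lia.
  exact: geq_minr.
(* The far clusters cost 2^(n+1) rho^(3n) = 2 (2 rho^3)^n, and 2 rho^3 = theta^6 / 4. *)
rewrite exprS exprM -mulrA -exprMn ler_piMr// exprn_ile1//.
  by rewrite mulr_ge0// exprn_ge0// ltW.
rewrite /rho expr_div_n -exprM mulrCA.
have : theta ^+ (2 * 3) <= 4.
  rewrite mulnC exprM. have := theta3_lt2. have : 0 < theta ^+ 3 by rewrite exprn_gt0.
  rewrite expr2; nra.
have -> : 2 / 2 ^+ 3 = 4^-1 :> R by field.
lra.
Qed.

(** On the block the kernel centred at its left end is at least rho^N, so the kernel bound divided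
    by rho^N bounds the mass; (theta/2) / rho = 1/theta. *)
Lemma cluster_block : exists2 C : R, 0 < C & forall N,
  \sum_(r < (2 ^ N)%N) cluster (2 ^ N + r)%N <= C * (eps N * theta ^- N).
Proof.
have [C C0 HC] := cluster_block_kernel; exists C => // N.
have rN : 0 < rho ^+ N by rewrite exprn_gt0.
have -> : theta ^- N = (theta / 2) ^+ N / rho ^+ N.
  rewrite /rho -expr_div_n -exprVn; congr (_ ^+ _); field.
  by rewrite gt_eqF.
rewrite !mulrA ler_pdivlMr// -mulrA; apply: le_trans (HC N 0).
rewrite mulr_suml; apply: ler_sum => r _; rewrite ler_wpM2l ?cluster_ge0// subr0.
by rewrite -phi_pow2; apply: phi_anti; rewrite !ger0_norm// ler_nat ltnW.
Qed.

End kernel.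

(** Block bounds become tail bounds by a geometric sum, [eps] being antitone. It serves with q =
    1/theta for masses and with q = theta/2 for kernel sums. *)
Lemma dyadic_tail (w : nat -> R) (C q : R) (M T : nat) :
  (forall k, 0 <= w k) -> 0 < C -> 0 <= q < 1 ->
  (forall j, \sum_(s < (2 ^ j)%N) w (2 ^ j + s)%N <= C * (eps j * q ^+ j)) ->
  \sum_((2 ^ M)%N <= k < T) w k <= C / (1 - q) * (eps M * q ^+ M).
Proof.
move=> w0 C0 /andP[q0 q1] wC.
have H P : \sum_((2 ^ M)%N <= k < (2 ^ (M + P))%N) w k <= \sum_(M <= j < M + P) C * (eps j * q ^+ j).
  elim: P => [|P IH]; first by rewrite addn0 !big_geq.
  rewrite addnS (@big_cat_nat _ _ _ (2 ^ (M + P))%N)/= ?leq_exp2l ?leq_addr//.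
  rewrite big_nat_recr ?leq_addr//= lerD//; apply: le_trans (wC _).
  by rewrite -{1}[(2 ^ (M + P))%N]add0n big_addn expnS mul2n -addnn addnK big_mkord; under eq_bigr do rewrite addnC.
apply: (@le_trans _ _ (\sum_((2 ^ M)%N <= k < (2 ^ (M + T))%N) w k)).
  have [TM|MT] := leqP T (2 ^ M); first by rewrite big_geq// sumr_ge0.
  have TMT : (T <= 2 ^ (M + T))%N.
    by rewrite (leq_trans (ltnW (ltn_expl T (ltnSn 1))))// leq_exp2l// leq_addl.
  rewrite [leRHS](@big_cat_nat _ _ _ T)//= ?(ltnW MT)//.
  by apply: ler_wpDr => //; rewrite sumr_ge0.
apply: le_trans (H T) _.
apply: (@le_trans _ _ (\sum_(M <= j < M + T) (C * eps M) * q ^+ j)).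
  rewrite big_nat [leRHS]big_nat; apply: ler_sum => j /andP[Mj _].
  rewrite mulrA; apply: ler_wpM2r; first exact: exprn_ge0.
  by apply: ler_wpM2l; [exact: ltW|exact: eps_anti].
rewrite -mulr_sumr.
apply: (@le_trans _ _ (C * eps M * (q ^+ M / (1 - q)))).
  apply: ler_wpM2l; first by rewrite mulr_ge0 ?eps_ge0 ?ltW.
  by apply: geom_sum_lt1; rewrite q0.
by rewrite le_eqVlt; apply/orP; left; apply/eqP; ring.
Qed.

Lemma eps_pow4 n : eps (4 ^ n) = n.+1%:R^-1.
Proof. by rewrite /eps /lev trunc_expnK. Qed.

Lemma cluster_site n j s : (0 < n)%N -> (3 * n <= j)%N -> (j < 4 ^ n)%N ->
  (4 ^ n <= j + 2 ^ n.+1)%N ->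
  (2 ^ j.-1 < s + 2 ^ (j - 3 * n))%N -> (s < 2 ^ j.-1 + 2 ^ (j - 3 * n))%N ->
  cluster (2 ^ (4 ^ n) + (2 ^ j + s))%N =
    n.+1%:R^-1 * (theta / 2) ^+ (4 ^ n) * theta ^- (2 * (j - 3 * n)).
Proof.
move=> n0 nj jN Nj s1 s2.
have [j' jE] : exists j', j = j'.+1 by exists j.-1; lia.
have jE2 : (2 ^ j = 2 * 2 ^ j.-1)%N by rewrite jE expnS.
have K : (2 ^ (j - 3 * n) <= 2 ^ j.-1)%N by rewrite leq_exp2l//; lia.
rewrite clusterE//; last by lia.
rewrite /cluster_weight /cluster_window /lev trunc_expnK// eps_pow4 n0 Nj nj/= ifT//.
by apply/andP; split; lia.
Qed.

Lemma spike_site j : (0 < j)%N -> spike (2 ^ j + 2 ^ j.-1) = eps j * theta ^- j.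
Proof. by case: j => // j _; rewrite spikeE ?ltn_exp2l//= expnS mul2n eqxx. Qed.

End weights.

(** * Integrals against atoms and discrete laws *)

Section integral_facts.
Local Open Scope ereal_scope.
Context d (T : measurableType d) (R : realType).
Variable mu : {measure set T -> \bar R}.

(** The integral of a nonnegative function is a supremum over simple functions below it, so
    monotonicity holds without measurability. This spares the measurability of [btilde] and of the
    inner integral of [I2tilde] in their argument. *)
Lemma ge0_le_integral_nonmeas (D1 D2 : set T) (f1 f2 : T -> \bar R) :
  (forall x, D1 x -> 0 <= f1 x) -> (forall x, D2 x -> 0 <= f2 x) ->
  (forall x, (f1 \_ D1) x <= (f2 \_ D2) x) ->
  \int[mu]_(x in D1) f1 x <= \int[mu]_(x in D2) f2 x.
Proof.
move=> f10 f20 f12; rewrite !ge0_integralE//; apply: le_ereal_sup => _ [h /= hf <-].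
by exists h => //= x; exact: le_trans (hf x) (f12 x).
Qed.

(** The finite combination of indicators of the atoms is measurable and lies below the integrand,
    which itself may fail to be measurable. *)
Lemma integral_ge_atoms (I : eqType) (s : seq I) (pt : I -> T) (D : set T)
    (g : T -> \bar R) (c m : I -> R) :
  uniq s -> {in s &, injective pt} -> (forall i, measurable [set pt i]) ->
  (forall i, 0 <= c i)%R -> (forall x, D x -> 0 <= g x) ->
  (forall i, i \in s -> D (pt i) /\ (c i)%:E <= g (pt i)) ->
  (forall i, i \in s -> (m i)%:E <= mu [set pt i]) ->
  (\sum_(i <- s) c i * m i)%:E <= \int[mu]_(x in D) g x.
Proof.
move=> us inj ms c0 g0 sc sm.
apply: (@le_trans _ _ (\sum_(i <- s) (c i)%:E * mu [set pt i])).
  rewrite -sumEFin big_seq [X in _ <= X]big_seq.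
  by apply: lee_sum => i si; rewrite EFinM lee_wpmul2l ?lee_fin ?sm.
pose ci i x : \bar R := (c i * \1_[set pt i] x)%:E.
have mc i : measurable_fun [set: T] (ci i).
  by apply/measurable_EFinP; apply: measurable_funM => //; exact: measurable_indic.
have c1 i x : 0 <= (c i * \1_[set pt i] x)%:E.
  by rewrite lee_fin mulr_ge0// indicE.
apply: (@le_trans _ _ (\int[mu]_(x in setT) (\sum_(i <- s) (c i * \1_[set pt i] x)%:E))).
  rewrite ge0_integral_sum//.
  apply: lee_sum => i _; under eq_integral do rewrite EFinM.
  rewrite ge0_integralZl//= ?integral_indic ?setIT//.
    by apply/measurable_EFinP; exact: measurable_indic.
  by rewrite lee_fin.
apply: ge0_le_integral_nonmeas => // [x _|x]; first exact: sume_ge0.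
rewrite patch_setT.
have pos : 0 <= (g \_ D) x by rewrite /patch; case: ifPn => // /[!inE] /g0.
have [/hasP[i si /eqP xi]|no] := boolP (has (fun i => x == pt i) s); last first.
  rewrite big_seq big1// => i si; rewrite indicE memNset ?mulr0// => /= xi.
  by move/hasPn: no => /(_ _ si); rewrite xi eqxx.
rewrite (bigD1_seq i)//= big_seq_cond big1 ?adde0.
  rewrite indicE mem_set//= mulr1 xi; have [Di gi] := sc _ si.
  by rewrite patchE mem_set.
move=> j /andP[sj ji]; rewrite indicE memNset ?mulr0//= xi => /(inj _ _ si sj) ij.
by rewrite ij eqxx in ji.
Qed.

End integral_facts.

(** * Probabilities carried by the integers *)

Section discrete_law.
Context {R : realType}.
Local Notation TR := (measurableTypeR R).
Variables wp wn : nat -> R.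
Hypothesis wp_ge0 : forall k, 0 <= wp k.
Hypothesis wn_ge0 : forall k, 0 <= wn k.
Hypothesis total_mass : (\sum_(0 <= k <oo) (wp k + wn k)%:E = 1)%E.

Let atoms (k : nat) : {measure set TR -> \bar R} :=
  measure_add (mscale (NngNum (wp_ge0 k)) (dirac (k%:R : TR)))
              (mscale (NngNum (wn_ge0 k)) (dirac (- k%:R : TR))).

Let mu : {measure set TR -> \bar R} := mseries atoms 0.

Let mu_T : mu setT = 1%E.
Proof.
rewrite -total_mass /mu /= /mseries; apply: eq_eseriesr => k _.
by rewrite [LHS]measure_addE /= /mscale/= !diracT !mule1 EFinD.
Qed.

(** Normalization supplies the [probability] structure for any weights; under [total_mass] it leaves
    [mu] unchanged, and the Dirac mass is only the fallback value. *)
Definition discrete_law : probability TR R := mnormalize mu (dirac (0 : TR)).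

Let discrete_lawE B : discrete_law B = mu B.
Proof.
rewrite /discrete_law/= /mnormalize mu_T /= onee_eq0/=.
by rewrite invr1 mule1.
Qed.

Lemma integral_discrete_law (D : set R) (g : R -> R) :
  measurable (D : set TR) -> measurable_fun (D : set TR) (g : TR -> R) ->
  (forall x, D x -> 0 <= g x) ->
  (\int[discrete_law]_(x in D) (g x)%:E =
   \sum_(0 <= k <oo) (wp k * (\1_D k%:R * g k%:R) +
                      wn k * (\1_D (- k%:R) * g (- k%:R)))%:E)%E.
Proof.
move=> mD mg g0; have mg' := (measurable_EFinP D g).2 mg.
transitivity (\int[mu]_(x in D) (g x)%:E)%E.
  by apply: eq_measure_integral => A _ _; exact: discrete_lawE.
have g0' x : D x -> (0 <= (g x)%:E)%E by move=> Dx; rewrite lee_fin g0.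
rewrite ge0_integral_measure_series//; apply: eq_eseriesr => k _.
by rewrite ge0_integral_measure_add// !ge0_integral_mscale// !integral_dirac.
Qed.

Lemma discrete_law_measurableE (B : set R) : measurable (B : set TR) ->
  (discrete_law B =
   \sum_(0 <= k <oo) (wp k * \1_B k%:R + wn k * \1_B (- k%:R))%:E)%E.
Proof.
move=> mB; have := integral_discrete_law mB (measurable_cst (1 : R)) (fun _ _ => ler01).
rewrite /= (integral_cst _ mB 1) mul1e => ->; apply: eq_eseriesr => k _.
by rewrite !mulr1.
Qed.

Let measurable_pt (x : R) : measurable ([set x] : set TR).
Proof. exact: measurable_set1. Qed.

Lemma discrete_law_pos_atom k : ((wp k)%:E <= discrete_law [set (k%:R : R)])%E.
Proof.
rewrite discrete_law_measurableE//.
pose u i := (wp i * \1_[set (k%:R : R)] i%:R + wn i * \1_[set (k%:R : R)] (- i%:R))%:E.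
have u0 i : (0 <= u i)%E by rewrite /u lee_fin addr_ge0// mulr_ge0// indicE.
apply: (@le_trans _ _ (u k)).
  by rewrite /u !indicE mem_set// mulr1 lee_fin lerDl mulr_ge0.
apply: le_trans (nneseries_lim_ge (u_ := u) k.+1 (fun i _ _ => u0 i)).
by rewrite big_nat_recr//= leeDr// sume_ge0.
Qed.

Lemma discrete_law_neg_atom k : ((wn k)%:E <= discrete_law [set (- k%:R)%R])%E.
Proof.
rewrite discrete_law_measurableE//.
pose u i := (wp i * \1_[set (- k%:R : R)] i%:R + wn i * \1_[set (- k%:R : R)] (- i%:R))%:E.
have u0 i : (0 <= u i)%E by rewrite /u lee_fin addr_ge0// mulr_ge0// indicE.
apply: (@le_trans _ _ (u k)).
  by rewrite /u [X in wn k * X]indicE mem_set// mulr1 lee_fin lerDr mulr_ge0// indicE.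
apply: le_trans (nneseries_lim_ge (u_ := u) k.+1 (fun i _ _ => u0 i)).
by rewrite big_nat_recr//= leeDr// sume_ge0.
Qed.

End discrete_law.

(** * The scale function and its kernels *)

Section limits.
Context {R : realType}.
Implicit Types (f : R -> R).

Lemma cvgy_rate f (l C x0 : R) :
  (forall x, x0 <= x -> `|f x - l| <= C / x) -> f x @[x --> +oo] --> l.
Proof.
move=> fl; apply/cvgrPdist_le => e e0.
near=> x; rewrite distrC; apply: le_trans (fl x _) _.
  by near: x; apply: nbhs_pinfty_ge; rewrite num_real.
have x1 : 0 < x by near: x; apply: nbhs_pinfty_gt; rewrite num_real.
by rewrite ler_pdivrMr// mulrC -ler_pdivrMr.
Unshelve. all: by end_near. Qed.

(** For an exponent in [0, 1], the power r^a lies between 1 and r. *)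
Lemma powR_dist1 (r a : R) : 0 < r -> 0 <= a <= 1 -> `|r `^ a - 1| <= `|r - 1|.
Proof.
move=> r0 /andP[a0 a1]; have [r1|r1] := leP 1 r.
  have h : 1 <= r `^ a by rewrite -(powRr0 r) ler_powR.
  by rewrite !ger0_norm ?subr_ge0// lerB// ler1_powR.
have h : r `^ a <= 1 by rewrite -(powRr0 r) ger_powR// r0 ltW.
rewrite !ler0_norm ?subr_le0// ?(ltW r1)// !opprB lerB// ger1_powR// r0 ltW//.
Qed.

End limits.

Section scale.
Context {R : realType} (a : R).
Hypothesis a_gt0 : 0 < a.
Hypothesis a_lt : a < 1 / 3.

Let b : R := 2 `^ a^-1 - 1.

(** A shifted power, smooth up to 0; the value 2^(1/a) - 1 of [b] is dictated by the normalization
    A(0) = 1/2, A(1) = 1. *)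
Definition stable_scale (s : R) : R := 2^-1 * (1 + b * s) `^ a.

Local Notation scale := stable_scale.

Let b_ge1 : 1 <= b.
Proof.
rewrite /b lerBrDr -[X in X <= _](_ : 2 `^ 1 = 1 + 1); last by rewrite powRr1.
apply: ler_powR; first by lra.
by rewrite -[leLHS]invr1 lef_pV2 ?posrE//; have := a_lt; lra.
Qed.

Let base_ge1 (s : R) : 0 <= s -> 1 <= 1 + b * s.
Proof. by move=> s0; rewrite lerDl mulr_ge0// (le_trans ler01). Qed.

Lemma scale0 : scale 0 = 2^-1.
Proof. by rewrite /scale mulr0 addr0 powR1 mulr1. Qed.

Lemma scale1 : scale 1 = 1.
Proof.
rewrite /scale mulr1 /b addrC subrK -powRrM mulVf ?gt_eqF// powRr1//.
by rewrite mulVf.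
Qed.

Lemma scale_gt0 s : 0 <= s -> 0 < scale s.
Proof. by move=> s0; rewrite mulr_gt0// powR_gt0// (lt_le_trans ltr01 (base_ge1 s0)). Qed.

Lemma scale_lt x y : 0 <= x -> x < y -> scale x < scale y.
Proof.
move=> x0 xy; rewrite ltr_pM2l// gt0_ltr_powR// ?nnegrE.
- by rewrite (le_trans ler01 (base_ge1 _)).
- by rewrite (le_trans ler01 (base_ge1 _))// (le_trans x0)// ltW.
by rewrite ltrD2l ltr_pM2l// (lt_le_trans ltr01).
Qed.

Lemma scale_le x y : 0 <= x -> x <= y -> scale x <= scale y.
Proof.
by move=> x0; rewrite le_eqVlt => /predU1P[->//|xy]; exact/ltW/scale_lt.
Qed.

Lemma scale_le_powR s : 0 <= s -> scale s <= Num.max s 1 `^ a.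
Proof.
move=> s0; rewrite /scale.
have m0 : 0 <= Num.max s 1 by rewrite le_max ler01 orbT.
apply: (@le_trans _ _ (2^-1 * (2 `^ a^-1 * Num.max s 1) `^ a)).
  rewrite ler_wpM2l// ge0_ler_powR ?nnegrE ?mulr_ge0 ?powR_ge0 ?(ltW a_gt0)//.
    by rewrite (le_trans ler01 (base_ge1 _)).
  have -> : 2 `^ a^-1 = 1 + b by rewrite /b addrC subrK.
  rewrite [leRHS]mulrDl mul1r lerD// ?le_max ?lexx ?orbT//.
  by rewrite ler_wpM2l ?(le_trans ler01)// le_max lexx.
rewrite powRM ?powR_ge0// -powRrM mulVf ?gt_eqF// powRr1//.
by rewrite mulrA mulVf// mul1r.
Qed.

Lemma scale_ge_powR s : 0 <= s -> 2^-1 * s `^ a <= scale s.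
Proof.
move=> s0; rewrite ler_wpM2l// ge0_ler_powR ?nnegrE ?(ltW a_gt0)//.
  by rewrite (le_trans ler01 (base_ge1 _)).
by rewrite (@le_trans _ _ (b * s))// ?lerDr// ler_peMl.
Qed.

Let is_derive_scale (s : R) : 0 <= s ->
  is_derive s (1 : R) scale (2^-1 * (a * (1 + b * s) `^ (a - 1) * b)).
Proof.
move=> s0; have p := lt_le_trans ltr01 (base_ge1 s0).
have D1 : is_derive s 1 (fun u : R => 1 + b * u) b.
  have := is_deriveD (is_derive_cst (1 : R) s 1) (is_deriveZ b (is_derive_id s (1 : R))).
  by rewrite add0r [b *: 1]mulr1.
have D2 := @is_derive1_comp _ _ (fun u : R => 1 + b * u) s _ _ (is_derive1_powR a p) D1.
have D3 := is_deriveZ (2^-1) D2.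
exact D3.
Qed.

Lemma RV_scale : RV a scale.
Proof.
exists (fun x => 2^-1 * (b + x^-1) `^ a); last first.
  move=> x x0; rewrite /scale mulrCA -powRM ?ltW//; last first.
    by rewrite addr_gt0 ?invr_gt0// (lt_le_trans ltr01).
  by rewrite mulrDr divff ?gt_eqF// addrC (mulrC x).
have b0 : 0 < b by exact: lt_le_trans b_ge1.
split.
- apply: measurable_funM => //.
  apply: (@measurableT_comp _ _ _ _ _ _ (@powR R ^~ a)) => //.
  apply: measurable_funD => //; apply: open_continuous_measurable_fun.
    exact: interval_open.
  by move=> x /[!inE]; rewrite /= in_itv/= andbT => x0; apply: inv_continuous; rewrite gt_eqF.
- near=> x; rewrite mulr_gt0// powR_gt0// addr_gt0// invr_gt0.
  by near: x; apply: nbhs_pinfty_gt; rewrite num_real.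
move=> c c0; apply: (@cvgy_rate _ _ _ `|c^-1 - 1| 1) => x x1.
have x0 : 0 < x by exact: lt_le_trans x1.
have bx : 0 < b + x^-1 by rewrite addr_gt0// invr_gt0.
have bcx : 0 < b + (c * x)^-1 by rewrite addr_gt0// invr_gt0 mulr_gt0.
have -> : 2^-1 * (b + (c * x)^-1) `^ a / (2^-1 * (b + x^-1) `^ a)
    = ((b + (c * x)^-1) / (b + x^-1)) `^ a.
  rewrite powRM ?invr_ge0 ?(ltW bx) ?(ltW bcx)//.
  have -> : (b + x^-1)^-1 `^ a = ((b + x^-1) `^ a)^-1.
    by rewrite -powR_inv1 ?(ltW bx)// -powRrM mulN1r powRN.
  by rewrite -mulf_div mulfV ?mul1r// invr_eq0.
apply: le_trans (powR_dist1 _ _) _; first by rewrite divr_gt0.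
  by have := a_lt; have := a_gt0; lra.
have -> : (b + (c * x)^-1) / (b + x^-1) - 1 = (c^-1 - 1) / x / (b + x^-1).
  field; apply/and3P; split; rewrite ?gt_eqF//.
  by rewrite addr_gt0// mulr_gt0.
rewrite normrM [`|(b + _)^-1|]gtr0_norm ?invr_gt0// normrM [`|x^-1|]gtr0_norm ?invr_gt0//.
rewrite ler_piMr//; first by rewrite mulr_ge0// invr_ge0 ltW.
by rewrite invf_le1// (le_trans b_ge1)// lerDl invr_ge0 ltW.
Unshelve. all: by end_near. Qed.

Lemma normalized_scale : standard_normalization a scale.
Proof.
split.
- exact: scale_gt0.
- exact: scale_lt.
- split=> [x x0|].
    by have [] := is_derive_scale (ltW x0).
  (* The formula for [scale] is differentiable on both sides of 0, since 1 + b s is positive near 0;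
     the one-sided limit is a restriction. *)
  have [d _] := is_derive_scale (lexx 0).
  move: d; rewrite /derivable => /cvg_ex[l dl]; apply/cvg_ex; exists l.
  have -> : (fun t => (scale t - scale 0) / t) =
            (fun h => h^-1 *: (scale (h *: 1 + 0) - scale 0)).
    by apply/funext => h; rewrite addr0 [h *: 1]mulr1 mulrC.
  apply: cvg_trans dl; apply: cvg_app.
  by apply: within_subset => h /= h0; rewrite gt_eqF.
- apply: (@cvgy_rate _ _ _ 1 1) => x x1.
  have x0 : 0 < x by exact: lt_le_trans x1.
  have [_ D] := is_derive_scale (ltW x0); rewrite derive1E D /scale.
  have p : 0 < 1 + b * x by exact: lt_le_trans ltr01 (base_ge1 (ltW x0)).
  have pa : 0 < (1 + b * x) `^ a by rewrite powR_gt0.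
  rewrite powRB ?powRr1 ?(ltW p)//; last by apply/implyP => _; rewrite gt_eqF.
  have -> : 2^-1 * (a * ((1 + b * x) `^ a / (1 + b * x)) * b) /
     (a * (2^-1 * (1 + b * x) `^ a) / x) - 1 = - (1 + b * x)^-1.
    by field; rewrite !gt_eqF//.
  rewrite normrN gtr0_norm ?invr_gt0// mul1r lef_pV2 ?posrE//.
  by rewrite (@le_trans _ _ (b * x))// ?lerDr// ler_peMl// ltW.
by rewrite scale0 scale1.
Qed.

Definition two_pow : R := 2 `^ a.

Local Notation theta := two_pow.

Lemma pow2_powR (i : nat) (r : R) : (2 ^ i)%:R `^ r = (2 `^ r) ^+ i.
Proof. by rewrite natrX -powR_mulrn// powRAC powR_mulrn// powR_ge0. Qed.

Lemma two_pow_gt1 : 1 < theta.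
Proof.
have : 1 `^ a < theta by apply: gt0_ltr_powR; rewrite ?nnegrE// ltr1n.
by rewrite powR1.
Qed.

Lemma two_pow3_lt2 : theta ^+ 3 < 2.
Proof.
rewrite /theta -powR_mulrn ?powR_ge0// -powRrM -[ltRHS](@powRr1 _ 2)//.
rewrite /powR !gt_eqF// ltr_expR ltr_pM2r ?ln_gt0 ?ltr1n//.
by have := a_lt; lra.
Qed.

Let theta_gt0 : 0 < theta. Proof. exact: lt_trans two_pow_gt1. Qed.

Lemma theta2E : 2 `^ (2 * a - 1) = theta ^+ 2 / 2.
Proof.
rewrite powRB ?powRr1//; last by apply/implyP.
by rewrite (mulrC _ a) powRrM powR_mulrn// powR_ge0.
Qed.

Lemma theta3E : 2 `^ (3 * a - 1) = theta ^+ 3 / 2.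
Proof.
rewrite powRB ?powRr1//; last by apply/implyP.
by rewrite (mulrC _ a) powRrM powR_mulrn// powR_ge0.
Qed.

(** Up to a constant this majorizes [btilde] of order 2, whose integrand A(t)^2 / t^2 is of order
    t^(2a-2). It is the kernel to which the abstract cluster bounds are applied. *)
Definition power_kernel (y : R) : R := Num.max `|y| 1 `^ (2 * a - 1).

Local Notation kern := power_kernel.

Lemma kern_ge0 y : 0 <= kern y. Proof. exact: powR_ge0. Qed.

Lemma powR_anti (r x y : R) : r <= 0 -> 0 < x -> x <= y -> y `^ r <= x `^ r.
Proof.
move=> r0 x0 xy; have y0 := lt_le_trans x0 xy.
rewrite -(opprK r) ![_ `^ (- - r)]powRN lef_pV2 ?posrE ?powR_gt0//.
by apply: ge0_ler_powR; rewrite ?oppr_ge0 ?nnegrE ?(ltW x0) ?(ltW y0).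
Qed.

Let maxy1_gt0 (y : R) : 0 < Num.max y 1. Proof. by rewrite lt_max ltr01 orbT. Qed.

Lemma kern_anti u v : `|u| <= `|v| -> kern v <= kern u.
Proof.
move=> uv; apply: powR_anti => //; first by have := a_lt; lra.
by rewrite ge_max !le_max uv lexx !orbT.
Qed.

Lemma kern_pow2 i : kern (2 ^ i)%:R = (theta ^+ 2 / 2) ^+ i.
Proof.
rewrite /kern ger0_norm// max_l; last by rewrite ler1n expn_gt0.
by rewrite pow2_powR theta2E.
Qed.

Definition invscale (k : nat) : R := (scale k%:R)^-1.

Lemma invscale_gt0 k : 0 < invscale k. Proof. by rewrite invr_gt0 scale_gt0. Qed.

Lemma invscale_anti k : invscale k.+1 <= invscale k.
Proof. by rewrite lef_pV2 ?posrE ?scale_gt0// scale_le// ler_nat. Qed.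

Lemma invscale_le k : (0 < k)%N -> invscale k <= 2 * k%:R `^ (- a).
Proof.
move=> k0; rewrite powRN -[X in X * _]invrK -invfM lef_pV2 ?posrE ?scale_gt0//.
  exact: scale_ge_powR.
by rewrite mulr_gt0// powR_gt0// ltr0n.
Qed.

(** A mean value bound without derivatives: with t = 1 + b k the increment is 2 t^(-a) (1 - q^a),
    where q = t / (t + b) <= 1 satisfies q <= q^a, and 1 - q <= b / t. *)
Lemma invscale_sub_le k : invscale k - invscale k.+1 <= 2 * b * k.+1%:R `^ (- a - 1).
Proof.
pose t := 1 + b * k%:R.
have b0 : 0 < b by exact: lt_le_trans b_ge1.
have kt : k.+1%:R <= t by rewrite -natr1 addrC lerD2l ler_peMl.
have k0 : 0 < k.+1%:R :> R by [].
have t0 : 0 < t by exact: lt_le_trans kt.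
have tb : 0 < t + b by rewrite addr_gt0.
have E : scale k.+1%:R = 2^-1 * (t + b) `^ a.
  by rewrite /scale /t -[k.+1%:R]natr1 [b * _]mulrDr mulr1 addrA.
rewrite /invscale E /scale -/t !invfM !invrK -mulrBr -mulrA ler_wpM2l//.
have ta : 0 < t `^ a by rewrite powR_gt0.
have -> : ((t + b) `^ a)^-1 = (t `^ a)^-1 * (t / (t + b)) `^ a.
  rewrite powRM ?invr_ge0 ?ltW// mulKf ?gt_eqF//.
  by rewrite -[(t + b)^-1]powR_inv1 ?ltW// -powRrM mulN1r powRN.
have q : t / (t + b) <= (t / (t + b)) `^ a.
  apply: ger1_powR; last by have := a_lt; lra.
  by rewrite divr_gt0//= ler_pdivrMr// mul1r lerDl ltW.
rewrite -[X in X - _]mulr1 -mulrBr.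
apply: (@le_trans _ _ ((t `^ a)^-1 * (b / t))).
  apply: ler_wpM2l; first by rewrite invr_ge0 ltW.
  apply: (@le_trans _ _ (1 - t / (t + b))); first by rewrite lerD2l lerN2.
  have -> : 1 - t / (t + b) = b / (t + b) by field; rewrite gt_eqF.
  by rewrite ler_wpM2l ?(ltW b0)// lef_pV2 ?posrE// lerDl ltW.
rewrite mulrCA ler_wpM2l ?(ltW b0)// powRB; last by apply/implyP => _; rewrite gt_eqF.
rewrite powRr1// powRN ler_pM ?invr_ge0 ?powR_ge0 ?(ltW t0)//.
  rewrite lef_pV2 ?posrE ?powR_gt0//.
  by apply: ge0_ler_powR; rewrite ?nnegrE ?(ltW a_gt0) ?(ltW t0).
by rewrite lef_pV2 ?posrE.
Qed.

Lemma scale_ratio_cvg (n : R -> nat) :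
  (forall x, 1 <= x -> x - 1 <= (n x)%:R <= x) ->
  scale x * invscale (n x) @[x --> +oo] --> (1 : R).
Proof.
move=> nx; apply: (@cvgy_rate _ _ _ (2 * b) 2) => x x2.
have b0 : 0 < b by exact: lt_le_trans b_ge1.
have /andP[n1 n2] : x - 1 <= (n x)%:R <= x by apply: nx; lra.
have x0 : 0 <= x by lra.
pose t := 1 + b * (n x)%:R; pose u := 1 + b * x.
have t0 : 0 < t by exact: lt_le_trans ltr01 (base_ge1 _).
have u0 : 0 < u by exact: lt_le_trans ltr01 (base_ge1 _).
have -> : scale x * invscale (n x) = (u / t) `^ a.
  rewrite /invscale /scale -/u -/t powRM ?invr_ge0 ?ltW//.
  have -> : t^-1 `^ a = (t `^ a)^-1 by rewrite -powR_inv1 ?ltW// -powRrM mulN1r powRN.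
  by rewrite -mulf_div mulfV ?mul1r// invr_eq0.
apply: le_trans (powR_dist1 _ _) _; first by rewrite divr_gt0.
  by have := a_lt; have := a_gt0; lra.
have -> : u / t - 1 = b * (x - (n x)%:R) / t by rewrite /u /t; field; rewrite -/t gt_eqF.
rewrite ger0_norm; last by rewrite divr_ge0 ?mulr_ge0 ?(ltW b0) ?(ltW t0)//; lra.
rewrite ler_pdivrMr// mulrAC ler_pdivlMr; last by lra.
have h1 : x - (n x)%:R <= 1 by lra.
have h2 : (n x)%:R <= t by rewrite /t -[leLHS]add0r lerD// ler_peMl.
have h3 : b * (x - (n x)%:R) <= b by rewrite ler_piMr// ltW.
have h4 : x <= 2 * t by lra.
rewrite [leRHS](_ : _ = b * (2 * t)); last by ring.
by apply: ler_pM; rewrite ?mulr_ge0 ?(ltW b0) ?subr_ge0.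
Qed.

Lemma b_scale_ge0 k t : 0 <= b_ scale k t / Num.max t 1.
Proof.
rewrite /b_ !mulr_ge0 ?exprn_ge0 ?invr_ge0 ?le_max ?ler01 ?orbT// ltW//.
exact: scale_gt0.
Qed.

(** Only the range [K, 2K] with K = 2^i is kept. There A(t) >= t^a / 2 gives an integrand of at
    least (2K)^(3a-2) / 8; multiplied by the length K this is theta^3 / 32 times (theta^3/2)^i, and
    theta^3 >= 1 is dropped. *)
Lemma btilde3_ge (i : nat) (z y : R) : `|y| <= 2 ^+ i -> 2 ^+ i.+1 <= `|z| ->
  ((32%:R^-1 * (theta ^+ 3 / 2) ^+ i)%:E <= btilde scale 3 z y)%E.
Proof.
move=> yi iz; pose K : R := 2 ^+ i.
pose c : R := 8^-1 * (2 * K) `^ (3 * a - 2).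
have K1 : 1 <= K by rewrite exprn_ege1// ler1n.
have K0 : 0 < K by exact: lt_le_trans K1.
have KE : K = (2 ^ i)%:R by rewrite natrX.
have K2 : (2 * K) `^ (3 * a - 2) = (theta ^+ 3 / 2) ^+ i.+1 / (2 * K).
  have -> : 2 * K = (2 ^ i.+1)%:R by rewrite natrX exprS.
  have -> : 3 * a - 2 = 3 * a - 1 - 1 by ring.
  rewrite powRB ?powRr1 ?pow2_powR ?theta3E//.
  by apply/implyP => _; rewrite pnatr_eq0 -lt0n expn_gt0.
apply: (@le_trans _ _ (\int[lebesgue_measure]_(t in `[K, (2 * K)%R]) cst c%:E t)%E).
  rewrite integral_cst//= lebesgue_measure_itv/= lte_fin ltr_pMl ?ltr1n//.
  rewrite -EFinB -EFinM lee_fin /c K2.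
  have t1 : 1 <= theta ^+ 3 by rewrite exprn_ege1// ltW// two_pow_gt1.
  have r0 : 0 <= (theta ^+ 3 / 2) ^+ i by rewrite exprn_ge0// divr_ge0// (le_trans ler01).
  have -> : 8^-1 * ((theta ^+ 3 / 2) ^+ i.+1 / (2 * K)) * (2 * K - K)
       = 32^-1 * (theta ^+ 3) * (theta ^+ 3 / 2) ^+ i.
    by rewrite exprS; field; rewrite gt_eqF.
  by rewrite -mulrA ler_wpM2l// ler_peMl.
apply: ge0_le_integral_nonmeas => [t _|t _|t].
- by rewrite lee_fin /c mulr_ge0 ?powR_ge0.
- by rewrite lee_fin b_scale_ge0.
rewrite !patchE; case: ifPn => [|_]; last first.
  by case: ifPn => // _; rewrite lee_fin b_scale_ge0.
rewrite inE/= in_itv/= => /andP[Kt tK].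
rewrite ifT; last first.
  rewrite inE/= in_itv/= (le_trans yi Kt) (le_trans tK)// (le_trans _ iz)//.
  by rewrite exprS.
have t1 : 1 <= t by exact: le_trans Kt.
have t0 : 0 < t by exact: lt_le_trans t1.
rewrite lee_fin /c /b_ gtr0_norm// max_l//.
apply: (@le_trans _ _ (8^-1 * t `^ (3 * a - 2))).
  rewrite ler_wpM2l// powR_anti//; by have := a_lt; lra.
have -> : 8^-1 * t `^ (3 * a - 2) = (2^-1 * t `^ a) ^+ 3 / t / t.
  rewrite exprMn -[t `^ a ^+ 3]powR_mulrn ?powR_ge0// -powRrM (mulrC a).
  rewrite powRB; last by apply/implyP => _; rewrite gt_eqF.
  rewrite powR_mulrn ?(ltW t0)//; field; rewrite gt_eqF//.
rewrite !ler_wpM2r ?invr_ge0 ?(ltW t0)// lerXn2r ?nnegrE ?mulr_ge0 ?powR_ge0 ?(ltW (scale_gt0 (ltW t0)))//.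
exact/scale_ge_powR/ltW.
Qed.

(** Below 1 the integrand is at most 1, which matters only for |y| < 1. Above 1 it is at most
    t^(2a-2), integrable at infinity because 2a < 1, with primitive t^(2a-1) / (2a-1). *)
Lemma btilde2_le (z y : R) :
  (btilde scale 2 z y <= ((1 + (1 - 2 * a)^-1) * kern y)%:E)%E.
Proof.
(* The upper end is enlarged by 1 so that Y < Z strictly, as the fundamental theorem of calculus
   demands. *)
pose Y : R := Num.max `|y| 1; pose Z : R := Num.max `|z| Y + 1.
pose r := 2 * a - 2.
have Y1 : 1 <= Y by rewrite le_max lexx orbT.
have Y0 : 0 < Y by exact: lt_le_trans Y1.
have YZ : Y < Z by rewrite ltr_pwDr// le_max lexx orbT.
have Z0 : 0 < Z by exact: lt_trans YZ.
have r1 : r + 1 = 2 * a - 1 by rewrite /r; ring.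
have r0 : r + 1 < 0 by rewrite r1; have := a_lt; lra.
pose f1 (t : R) : R := \1_`[`|y|, Y] t.
pose f2 (t : R) : R := \1_`[Y, Z] t * t `^ r.
have f10 t : 0 <= f1 t by rewrite /f1 indicE.
have f20 t : 0 <= f2 t by rewrite /f2 mulr_ge0 ?powR_ge0// indicE.
apply: (@le_trans _ _ (\int[lebesgue_measure]_(t in setT) ((f1 t)%:E + (f2 t)%:E))%E).
  apply: ge0_le_integral_nonmeas => [t _|t _|t].
  - by rewrite lee_fin b_scale_ge0.
  - by rewrite -EFinD lee_fin addr_ge0.
  rewrite patch_setT patchE; case: ifPn => [|_]; last by rewrite -EFinD lee_fin addr_ge0.
  rewrite inE/= in_itv/= => /andP[yt tz]; rewrite -EFinD lee_fin.
  have t0 : 0 <= t by exact: le_trans yt.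
  rewrite /b_ ger0_norm//.
  have [t1|t1] := leP t 1.
    rewrite /f1 indicE mem_set/=; last by rewrite in_itv/= yt le_max t1 orbT.
    rewrite !divr1; apply: ler_wpDr => //.
    rewrite exprn_ile1 ?(ltW (scale_gt0 t0))//; apply: le_trans (scale_le_powR t0) _.
    by rewrite max_r// powR1.
  rewrite /f2 indicE mem_set/=; last first.
    by rewrite in_itv/= ge_max yt (ltW t1)/= ler_wpDr// le_max tz.
  rewrite mul1r; apply: ler_wpDl => //.
  have tp : 0 < t by exact: lt_trans t1.
  have -> : t `^ r = (t `^ a) ^+ 2 / t / t.
    rewrite -[t `^ a ^+ 2]powR_mulrn ?powR_ge0// -powRrM (mulrC a) /r.
    rewrite powRB; last by apply/implyP => _; rewrite gt_eqF.
    by rewrite powR_mulrn ?(ltW tp)//; field; rewrite gt_eqF.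
  rewrite !ler_wpM2r ?invr_ge0 ?(ltW tp)// lerXn2r ?nnegrE ?powR_ge0 ?(ltW (scale_gt0 t0))//.
  by apply: le_trans (scale_le_powR t0) _; rewrite max_l// ltW.
have mpow (D : set R) : measurable_fun (D : set (measurableTypeR R)) (fun t : R => t `^ r).
  by apply: measurable_funTS; exact: measurable_powR.
rewrite ge0_integralD//; last 4 first.
- by move=> t _; rewrite lee_fin.
- by apply/measurable_EFinP; exact: measurable_indic.
- by move=> t _; rewrite lee_fin.
- by apply/measurable_EFinP; apply: measurable_funM => //; exact: measurable_indic.
rewrite mulrDl mul1r EFinD; apply: leeD.
  rewrite integral_indic//= setIT lebesgue_measure_itv/= lte_fin.
  case: ifPn => [yY|_]; last by rewrite lee_fin kern_ge0.
  have Y_1 : Y = 1 by move: yY; rewrite /Y lt_max ltxx /= => y1; rewrite max_r// ltW.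
  by rewrite -EFinB lee_fin /kern -/Y Y_1 powR1 gerBl.
have -> : (\int[lebesgue_measure]_(t in setT) (f2 t)%:E =
          \int[lebesgue_measure]_(t in `[Y, Z]) (t `^ r)%:E)%E.
  rewrite [RHS]integral_mkcond; apply: eq_integral => t _.
  by rewrite patchE /f2 indicE; case: ifPn => _; rewrite ?mul1r ?mul0r.
have D (t : R) : 0 < t -> is_derive t (1 : R) (fun t : R => (r + 1)^-1 * t `^ (r + 1)) (t `^ r).
  move=> t0; have D3 := is_deriveZ (r + 1)^-1 (is_derive1_powR (r + 1) t0).
  have E : (r + 1)^-1 *: ((r + 1) * t `^ (r + 1 - 1)) = t `^ r.
    by rewrite addrK [LHS]mulKf// lt_eqF.
  by rewrite E in D3; exact D3.
have Dc (t : R) : 0 < t -> {for t, continuous (fun t : R => (r + 1)^-1 * t `^ (r + 1))}.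
  by move=> /D[Dt _]; apply: differentiable_continuous; exact/derivable1_diffP.
rewrite (@continuous_FTC2 _ _ (fun t => (r + 1)^-1 * t `^ (r + 1)))//.
- rewrite -EFinB lee_fin /kern -/Y -r1.
  have -> : 1 - 2 * a = - (r + 1) by rewrite r1; ring.
  rewrite invrN mulNr lerBlDr addNr.
  by rewrite nmulr_rle0 ?powR_ge0// invr_lt0.
- apply: derivable_within_continuous => t; rewrite in_itv/= => /andP[Yt _].
  by have [] := is_derive1_powR r (lt_le_trans Y0 Yt).
- split.
  + by move=> t; rewrite in_itv/= => /andP[Yt _]; have [] := D _ (lt_trans Y0 Yt).
  + exact/cvg_at_right_filter/Dc.
  + exact/cvg_at_left_filter/Dc.
- move=> t; rewrite in_itv/= => /andP[Yt _].
  by have [_] := D _ (lt_trans Y0 Yt); rewrite derive1E.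
Qed.

End scale.

(** * Lower bounds for the renewal measure *)

Section step_operators.
Context {R : realType} (S : seq int).
Implicit Types (c u v w p : int -> R) (g : int -> R).

(** One step of a walk from [y], evaluated backward. The weights [c] may have mass below 1, so that
    small steps, cluster jumps and spike jumps can be treated as separate operators. *)
Definition step_op c g : int -> R := fun y => \sum_(i <- S) c i * g (y + i).

Definition potential c (M : nat) g : int -> R :=
  fun y => \sum_(n < M) iter n (step_op c) g y.

Definition nonneg g := forall y, 0 <= g y.

Lemma step_op_ge0 c g : nonneg c -> nonneg g -> nonneg (step_op c g).
Proof. by move=> c0 g0 y; apply: sumr_ge0 => i _; rewrite mulr_ge0. Qed.

Lemma iter_step_op_ge0 c g n : nonneg c -> nonneg g -> nonneg (iter n (step_op c) g).
Proof. by move=> c0 g0; elim: n => //= n IH; exact: step_op_ge0. Qed.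

Lemma potential_ge0 c g M : nonneg c -> nonneg g -> nonneg (potential c M g).
Proof. by move=> c0 g0 y; apply: sumr_ge0 => n _; exact: iter_step_op_ge0. Qed.

Lemma le_step_op c1 c2 g1 g2 : nonneg c1 -> nonneg g1 ->
  (forall i, c1 i <= c2 i) -> (forall y, g1 y <= g2 y) ->
  forall y, step_op c1 g1 y <= step_op c2 g2 y.
Proof. by move=> c0 g0 c12 g12 y; apply: ler_sum => i _; apply: ler_pM. Qed.

Lemma le_iter_step_op c1 c2 g1 g2 n : nonneg c1 -> nonneg g1 ->
  (forall i, c1 i <= c2 i) -> (forall y, g1 y <= g2 y) ->
  forall y, iter n (step_op c1) g1 y <= iter n (step_op c2) g2 y.
Proof.
by move=> c0 g0 c12 g12; elim: n => //= n IH; apply: le_step_op => //; exact: iter_step_op_ge0.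
Qed.

Lemma step_opD c1 c2 g y :
  step_op (fun i => c1 i + c2 i) g y = step_op c1 g y + step_op c2 g y.
Proof. by rewrite -big_split/=; apply: eq_bigr => i _; rewrite mulrDl. Qed.

Lemma step_op_suml (I : Type) (r : seq I) (c : I -> int -> R) g y :
  step_op (fun i => \sum_(j <- r) c j i) g y = \sum_(j <- r) step_op (c j) g y.
Proof. by rewrite exchange_big/=; apply: eq_bigr => i _; rewrite mulr_suml. Qed.

Lemma step_op_sumr (I : Type) (r : seq I) c (g : I -> int -> R) :
  step_op c (fun z => \sum_(j <- r) g j z) = fun y => \sum_(j <- r) step_op c (g j) y.
Proof.
apply/funext => y; rewrite /step_op exchange_big/=.
by apply: eq_bigr => i _; rewrite mulr_sumr.
Qed.

Lemma iter_step_op_sumr (I : Type) (r : seq I) c n (g : I -> int -> R) :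
  iter n (step_op c) (fun z => \sum_(j <- r) g j z) =
  fun y => \sum_(j <- r) iter n (step_op c) (g j) y.
Proof. by elim: n => //= n ->; rewrite step_op_sumr. Qed.

Lemma potentialS c M g y :
  potential c M.+1 g y = g y + step_op c (potential c M g) y.
Proof. by rewrite /potential big_ord_recl/= step_op_sumr. Qed.

Lemma step_opC c1 c2 g : step_op c1 (step_op c2 g) = step_op c2 (step_op c1 g).
Proof.
apply/funext => y; rewrite /step_op.
under eq_bigr do rewrite mulr_sumr.
rewrite exchange_big/=; apply: eq_bigr => i _; rewrite mulr_sumr.
by apply: eq_bigr => j _; rewrite mulrCA addrAC.
Qed.

Lemma iter_step_opC c1 c2 n g :
  step_op c1 (iter n (step_op c2) g) = iter n (step_op c2) (step_op c1 g).
Proof. by elim: n => //= n IH; rewrite step_opC IH. Qed.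

Lemma le_potential c1 c2 M1 M2 g1 g2 : nonneg c1 -> nonneg g1 -> (M1 <= M2)%N ->
  (forall i, c1 i <= c2 i) -> (forall y, g1 y <= g2 y) ->
  forall y, potential c1 M1 g1 y <= potential c2 M2 g2 y.
Proof.
move=> c0 g0 M12 c12 g12 y; rewrite /potential.
rewrite -(big_mkord xpredT (fun n => iter n (step_op c2) g2 y)) (@big_cat_nat _ _ _ M1)//=.
rewrite big_mkord; apply: ler_wpDr.
  apply: sumr_ge0 => n _; apply: le_trans (le_iter_step_op n c0 g0 c12 g12 y).
  exact: iter_step_op_ge0.
by apply: ler_sum => n _; exact: le_iter_step_op.
Qed.

(* The scenarios in which the first [v]-step comes after n [u]-steps, n < L, are disjoint. *)
Lemma potential_first_step p u v L M g : nonneg u -> nonneg v -> nonneg g ->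
  (forall i, u i + v i <= p i) -> forall y,
  \sum_(n < L) iter n (step_op u) (step_op v (potential p M g)) y
  <= potential p (L + M) g y.
Proof.
move=> u0 v0 g0 uvp.
have p0 : nonneg p by move=> i; apply: le_trans (uvp i); exact: addr_ge0.
have P0 : nonneg (potential p M g) by exact: potential_ge0.
elim: L => [|L IH] y; first by rewrite big_ord0 potential_ge0.
rewrite addSn potentialS; apply: ler_wpDl => //.
apply: le_trans (le_step_op _ _ uvp (fun=> lexx _) y); last 2 first.
- by move=> i; exact: addr_ge0.
- exact: potential_ge0.
rewrite step_opD big_ord_recl addrC; apply: lerD.
  under eq_bigr do rewrite lift0 iterS.
  pose h (n : 'I_L) := iter n (step_op u) (step_op v (potential p M g)).
  have -> : \sum_(i < L) step_op u (iter i (step_op u) (step_op v (potential p M g))) y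
     = step_op u (fun z => \sum_(i < L) h i z) y by rewrite (step_op_sumr _ u h).
  apply: le_step_op => // z; apply: sumr_ge0 => n _; apply: iter_step_op_ge0 => //.
  exact: step_op_ge0.
apply: le_step_op => // z; apply: le_potential => //; exact: leq_addl.
Qed.

(** The first step that is not a [u]-step is some [v j]-step and reveals j, so the scenarios for
    distinct j are disjoint. Given j, the first [w j]-step after [uj j]-steps separates the second
    run from the third. Two uses of [potential_first_step] express this; since step operators
    commute, the three runs merge into one power of length a + b + c. *)
Lemma potential_two_steps (r : seq nat) p u (uj v w : nat -> int -> R)
    (m : nat -> nat) L g y :
  nonneg u -> nonneg g -> (forall j, nonneg (uj j)) -> (forall j, nonneg (v j)) ->
  (forall j, nonneg (w j)) ->
  (forall i, u i + \sum_(j <- r) v j i <= p i) ->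
  (forall j i, j \in r -> uj j i <= u i) ->
  (forall j i, j \in r -> uj j i + w j i <= p i) ->
  (forall j, j \in r -> (m j <= L)%N) ->
  \sum_(j <- r) \sum_(a < m j) \sum_(b < m j) \sum_(c < m j)
     iter (a + b + c) (step_op (uj j)) (step_op (v j) (step_op (w j) g)) y
  <= potential p (L + (L + L)) g y.
Proof.
move=> u0 g0 uj0 v0 w0 uvp uju ujwp mL.
have p0 : nonneg p.
  move=> i; apply: le_trans (uvp i); apply: addr_ge0 => //; apply: sumr_ge0 => j _; exact: v0.
have V0 : nonneg (fun i => \sum_(j <- r) v j i) by move=> i; apply: sumr_ge0 => j _; exact: v0.
have P0 : nonneg (potential p (L + L) g) by exact: potential_ge0.
apply: le_trans (@potential_first_step p u (fun i => \sum_(j <- r) v j i) L (L + L) g u0 V0 g0 uvp y).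
rewrite (_ : \sum_(n < L) _ = \sum_(j <- r) \sum_(n < L)
    iter n (step_op u) (step_op (v j) (potential p (L + L) g)) y); last first.
  rewrite exchange_big/=; apply: eq_bigr => n _.
  transitivity (iter n (step_op u) (fun z => \sum_(j <- r) step_op (v j) (potential p (L + L) g) z) y).
    by congr (iter n _ _ y); apply/funext => z; rewrite step_op_suml.
  by rewrite iter_step_op_sumr.
rewrite big_seq [leRHS]big_seq; apply: ler_sum => j jr.
rewrite -(big_mkord xpredT (fun n => iter n (step_op u) (step_op (v j) (potential p (L + L) g)) y)).
rewrite (@big_cat_nat _ _ _ (m j))//= ?mL// big_mkord; apply: ler_wpDr.
  by apply: sumr_ge0 => n _; apply: iter_step_op_ge0 => //; exact: step_op_ge0.
apply: ler_sum => a _.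
have H z : \sum_(b < m j) \sum_(c < m j)
    iter b (step_op (uj j)) (step_op (w j) (iter c (step_op (uj j)) g)) z
    <= potential p (L + L) g z.
  apply: (@le_trans _ _ (potential p (m j + m j) g z)); last first.
    by apply: le_potential => //; rewrite leq_add// mL.
  apply: le_trans (@potential_first_step p (uj j) (w j) (m j) (m j) g (uj0 j) (w0 j) g0
    (fun i => ujwp j i jr) z).
  apply: ler_sum => b _.
  rewrite (_ : \sum_(c < m j) _ = iter b (step_op (uj j)) (fun z => \sum_(c < m j)
    step_op (w j) (iter c (step_op (uj j)) g) z) z); last by rewrite iter_step_op_sumr.
  apply: le_iter_step_op => //.
    by move=> ?; apply: sumr_ge0 => c _; apply: step_op_ge0 => //; exact: iter_step_op_ge0.
  move=> z'; rewrite (_ : \sum_(c < m j) _ = step_op (w j) (fun z => \sum_(c < m j)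
    iter c (step_op (uj j)) g z) z'); last by rewrite step_op_sumr.
  apply: le_step_op => //.
    by move=> ?; apply: sumr_ge0 => c _; exact: iter_step_op_ge0.
  move=> z2; apply: ler_sum => c _; apply: le_iter_step_op => // i.
  by apply: le_trans (ujwp j i jr); rewrite lerDl w0.
have Hg : nonneg (fun z => \sum_(b < m j) \sum_(c < m j)
    iter b (step_op (uj j)) (step_op (w j) (iter c (step_op (uj j)) g)) z).
  move=> z; apply: sumr_ge0 => b _; apply: sumr_ge0 => c _; apply: iter_step_op_ge0 => //.
  by apply: step_op_ge0 => //; exact: iter_step_op_ge0.
apply: (@le_trans _ _ (iter a (step_op (uj j)) (step_op (v j) (fun z => \sum_(b < m j) \sum_(c < m j)
    iter b (step_op (uj j)) (step_op (w j) (iter c (step_op (uj j)) g)) z)) y)); last first.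
  apply: le_iter_step_op => //; [exact: step_op_ge0|by move=> i; exact: uju|].
  exact: le_step_op.
pose G (b c : 'I_(m j)) :=
  iter b (step_op (uj j)) (step_op (w j) (iter c (step_op (uj j)) g)).
rewrite (step_op_sumr _ (v j) (fun b z => \sum_(c < m j) G b c z)).
rewrite (iter_step_op_sumr _ (uj j) a (fun b => step_op (v j) (fun z => \sum_(c < m j) G b c z))).
apply: ler_sum => b _.
rewrite (step_op_sumr _ (v j) (G b)) (iter_step_op_sumr _ (uj j) a (fun c : 'I_(m j) => step_op (v j) (G b c))).
apply: ler_sum => c _; rewrite /G.
by rewrite (iter_step_opC (w j) (uj j) c g) -(iterD b c)
  (iter_step_opC (v j) (uj j) (b + c)%N) -(iterD a) addnA.
Qed.

(* Markov's inequality: n steps of mean length at most E displace the walk by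
   less than K, up to probability n * E / K, and lose mass at most n * tau. *)
Lemma iter_step_op_ge (u g : int -> R) (D K tau E : R) (n : nat) (y : int) :
  nonneg u -> 0 <= D -> 0 < K -> 0 <= tau -> 0 <= E ->
  1 - tau <= \sum_(i <- S) u i <= 1 ->
  \sum_(i <- S) u i * `|i|%:~R <= E ->
  (forall z : int, D * (1 - `|z|%:~R / K) <= g z) ->
  D * (1 - n%:R * tau - (`|y|%:~R + n%:R * E) / K) <= iter n (step_op u) g y.
Proof.
move=> u0 D0 K0 tau0 E0 /andP[u1 u2] uE gD; elim: n y => [|n IH] y.
  by rewrite !mul0r subr0 addr0; exact: gD.
rewrite iterS.
apply: (@le_trans _ _ (\sum_(i <- S) u i * (D * (1 - n%:R * tau - (`|y + i|%:~R + n%:R * E) / K)))); last first.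
  by apply: ler_sum => i _; exact: ler_wpM2l.
apply: (@le_trans _ _ (D * ((\sum_(i <- S) u i) * (1 - n%:R * tau - (`|y|%:~R + n%:R * E) / K)
    - (\sum_(i <- S) u i * `|i|%:~R) / K))); last first.
  rewrite !mulr_suml -sumrB mulr_sumr; apply: ler_sum => i _.
  have -> : D * (u i * (1 - n%:R * tau - (`|y|%:~R + n%:R * E) / K) - u i * `|i|%:~R / K)
    = u i * (D * (1 - n%:R * tau - (`|y|%:~R + `|i|%:~R + n%:R * E) / K)).
    by rewrite !mulrDl; ring.
  apply: ler_wpM2l => //; apply: ler_wpM2l => //.
  rewrite lerD2l lerN2 ler_wpM2r ?invr_ge0 ?(ltW K0)// lerD2r -intrD ler_int.
  exact: ler_normD.
apply: ler_wpM2l => //.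
set s := \sum_(i <- S) u i in u1 u2 *; set e := \sum_(i <- S) _ in uE *.
pose x1 : R := n%:R * tau; pose y1 : R := `|y|%:~R / K; pose e1 := E / K.
have x10 : 0 <= x1 by rewrite mulr_ge0.
have y10 : 0 <= y1 by rewrite divr_ge0 ?(ltW K0)// ler0z.
have n0 : 0 <= n%:R * e1 by rewrite mulr_ge0// divr_ge0 ?(ltW K0).
have ee : e / K <= e1 by rewrite ler_wpM2r ?invr_ge0 ?(ltW K0).
have -> : 1 - n.+1%:R * tau - (`|y|%:~R + n.+1%:R * E) / K
  = 1 - x1 - tau - y1 - n%:R * e1 - e1.
  by rewrite -natr1 /x1 /y1 /e1; ring.
have -> : 1 - n%:R * tau - (`|y|%:~R + n%:R * E) / K = 1 - x1 - y1 - n%:R * e1.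
  by rewrite /x1 /y1 /e1; ring.
(* Writing Q for the subtracted terms, s (1 - Q) >= s - Q because s <= 1; this holds even when 1 - Q
   is negative. *)
have : (1 - s) * (x1 + y1 + n%:R * e1) >= 0.
  by rewrite mulr_ge0 ?subr_ge0// !addr_ge0.
nra.
Qed.

End step_operators.

(** * From step operators to the renewal measure *)

Section renewal_lower_bound.
Context {R : realType} (F : probability (measurableTypeR R) R).
Variables (S : seq int) (p : int -> R).
Hypothesis uniqS : uniq S.
Hypothesis p_ge0 : forall i, 0 <= p i.
Hypothesis p_le : forall i, i \in S -> ((p i)%:E <= F [set (i%:~R : R)])%E.

Lemma walk_law_ge (X : int) (n : nat) (y : int) :
  ((iter n (step_op S p) (fun z => (z == X)%:R) y)%:E
   <= walk_law F n [set ((X - y)%:~R : R)])%E.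
Proof.
elim: n y => [|n IH] y.
  rewrite /= diracE; have [->|yX] := eqVneq y X.
    by rewrite mem_set//= subrr.
  by rewrite /= lee_fin; case: (_ \in _).
rewrite iterS [walk_law F n.+1]/=.
(* The product measure unfolds to an integral of sections over the first coordinate, here the
   position after n steps; each step i of [S] then contributes the atom X - (y + i). *)
rewrite [leRHS](_ : _ = (\int[walk_law F n]_(a in setT)
   F (xsection (sum_pair @^-1` [set ((X - y)%:~R : R)]) a))%E)//.
apply: (@integral_ge_atoms _ _ _ (walk_law F n) int S (fun i => (X - (y + i))%:~R) setT _ p
  (fun i => iter n (step_op S p) (fun z => (z == X)%:R) (y + i))) => //.
- move=> i j _ _ /eqP; rewrite eqr_int => /eqP; lia.
- move=> i Si; split=> //; apply: le_trans (p_le Si) _; rewrite le_eqVlt.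
  apply/orP; left; apply/eqP; congr (F _); apply/seteqP; split => b /=.
    move=> ->; rewrite /xsection/= inE /sum_pair/=.
    by rewrite -intrD; congr (_%:~R); lia.
  rewrite /xsection/= inE /sum_pair/= => E.
  have -> : b = (X - y)%:~R - (X - (y + i))%:~R by rewrite -E addrAC subrr add0r.
  by rewrite -intrB; congr (_%:~R); lia.
Qed.

Lemma renewal_measure_ge (X : int) (M : nat) (h : R) : 0 < h ->
  ((potential S p M (fun z => (z == X)%:R) 0)%:E
   <= renewal_measure F `](X%:~R - h)%R, X%:~R])%E.
Proof.
move=> h0; rewrite /potential -sumEFin; set B := (X in renewal_measure F X).
apply: (@le_trans _ _ (\sum_(0 <= n < M) walk_law F n B)%E); last first.
  by apply: nneseries_lim_ge => n _ _.
rewrite big_mkord; apply: lee_sum => n _; apply: le_trans (walk_law_ge _ _ _) _.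
apply: le_measure; rewrite ?inE; [exact: measurable_set1|exact: measurable_itv|].
by move=> x /= ->; rewrite subr0 /B/= in_itv/= lexx andbT ltrBlDr ltrDl.
Qed.

End renewal_lower_bound.

(** * The law and its tails *)

Section series_limits.
Context {R : realType}.

Lemma nneseries_le_ub (u : nat -> R) (B : R) : (forall k, 0 <= u k) ->
  (forall T, \sum_(0 <= k < T) u k <= B) ->
  (\sum_(0 <= k <oo) (u k)%:E <= B%:E)%E.
Proof.
move=> u0 uB; apply: lime_le; first by apply: is_cvg_nneseries => k _ _; rewrite lee_fin.
by apply: nearW => T; rewrite sumEFin lee_fin.
Qed.

Lemma nneseries_ge_partial (u : nat -> R) (T : nat) : (forall k, 0 <= u k) ->
  ((\sum_(0 <= k < T) u k)%:E <= \sum_(0 <= k <oo) (u k)%:E)%E.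
Proof.
by move=> u0; rewrite -sumEFin; apply: nneseries_lim_ge => k _ _; rewrite lee_fin.
Qed.

(** As soon as [n x] exceeds 2^(4^m), the value is at most 1/(m+1). The slack factor 4 admits both
    an integer part of x and a power of two comparable to x. *)
Lemma eps_trunc_log_cvg0 (n : R -> nat) : (forall x, 1 <= x -> x - 1 <= 4 * (n x)%:R) ->
  eps (trunc_log 2 (n x)) @[x --> +oo] --> (0 : R).
Proof.
move=> nx; apply/cvgrPdist_le => e e0.
pose m := Num.truncn e^-1.
near=> x; rewrite sub0r normrN ger0_norm ?eps_ge0//.
apply: (@le_trans _ _ (eps (4 ^ m))).
  apply: eps_anti; apply: trunc_log_max => //.
  rewrite -(ler_nat R) -(ler_pM2l (ltr0n R 4)); apply: le_trans (nx x _).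
    rewrite lerBrDr; near: x; apply: nbhs_pinfty_ge; exact: num_real.
  near: x; apply: nbhs_pinfty_ge; exact: num_real.
rewrite eps_pow4 -[leRHS]invrK lef_pV2 ?posrE ?invr_gt0//.
by apply/ltW/truncnS_gt.
Unshelve. all: by end_near. Qed.

Lemma limf_esup_pinfty_ge (f : R -> \bar R) (c : \bar R) :
  (forall M, exists2 x, M < x & (c <= f x)%E) -> (c <= limf_esup f (pinfty_nbhs R))%E.
Proof.
move=> fc; rewrite limf_esupE; apply: le_ereal_inf_tmp => _ [V /= [M [_ MV]] <-].
have [x Mx cx] := fc M; apply: le_trans cx _; apply: ereal_sup_ubound.
by exists x => //; exact: MV.
Qed.

Lemma limf_esup_pinfty_le (f : R -> \bar R) (c : \bar R) :
  (\forall x \near +oo, (f x <= c)%E) -> (limf_esup f (pinfty_nbhs R) <= c)%E.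
Proof.
move=> fc; rewrite limf_esupE; apply: ge_ereal_inf.
exists (ereal_sup (f @` [set x | (f x <= c)%E])); first by exists [set x | (f x <= c)%E].
by apply: ge_ereal_sup => _ [x /= fx <-].
Qed.

End series_limits.

Section law.
Context {R : realType} (a : R).
Hypothesis a_gt0 : 0 < a.
Hypothesis a_lt : a < 1 / 3.
Local Notation theta := (two_pow a).
Local Notation scale := (stable_scale a).
Local Notation h := (invscale a).

Let theta_gt1 : 1 < theta := two_pow_gt1 a_gt0.
Let theta3_lt2 : theta ^+ 3 < 2 := two_pow3_lt2 a_lt.
Let theta_gt0 : 0 < theta. Proof. exact: lt_trans theta_gt1. Qed.

Let qth : 0 <= theta^-1 < 1.
Proof. by rewrite invr_ge0 ltW//= invf_lt1. Qed.

(** The main term is the increment of -1/A, so that tails telescope to 1/A exactly; the origin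
    carries no mass. *)
Definition raw (c : nat -> R) (k : nat) : R :=
  if k is k'.+1 then h k' - h k + c k else 0.

(** Since 1/A is of order theta^(-M) at 2^M, this says that the tails of [c] are negligible against
    1/A, with rate [eps]. *)
Definition dyadic_small (c : nat -> R) (C : R) : Prop :=
  (forall k, 0 <= c k) /\
  forall M T, \sum_((2 ^ M)%N <= k < T) c k <= C * (eps M * theta ^- M).

Lemma cluster_small : exists2 C, 0 < C & dyadic_small (cluster theta) C.
Proof.
have [C C0 HC] := cluster_block theta_gt1 theta3_lt2 (@kern_ge0 _ a) (kern_anti a_lt)
  (@kern_pow2 _ a).
have q := qth; have /andP[q0 q1] := q.
exists (C / (1 - theta^-1)); first by rewrite divr_gt0// subr_gt0.
split=> [k|M T]; first exact: cluster_ge0.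
rewrite -exprVn; apply: dyadic_tail => // [k|j]; first exact: cluster_ge0.
by rewrite exprVn.
Qed.

Lemma spike_small : exists2 C, 0 < C & dyadic_small (spike theta) C.
Proof.
have q := qth; have /andP[q0 q1] := q.
exists (1 / (1 - theta^-1)); first by rewrite divr_gt0// subr_gt0.
split=> [k|M T]; first exact: spike_ge0.
rewrite -exprVn; apply: dyadic_tail => // [k|j]; first exact: spike_ge0.
by rewrite mul1r exprVn; exact: spike_block.
Qed.

Lemma raw_ge0 c C k : dyadic_small c C -> 0 <= raw c k.
Proof.
by move=> [c0 _]; case: k => //= k; rewrite addr_ge0// subr_ge0 invscale_anti.
Qed.

Lemma raw_tail_eq c (n T : nat) : (n <= T)%N ->
  \sum_(n.+1 <= k < T.+1) raw c k = h n - h T + \sum_(n.+1 <= k < T.+1) c k.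
Proof.
move=> nT; rewrite !big_add1 /= big_split/=; congr (_ + _).
by rewrite -[RHS]opprB -telescope_sumr// -sumrN; apply: eq_bigr => k _; rewrite opprB.
Qed.

Lemma raw_tail_le c C (n T : nat) : dyadic_small c C -> (0 < n)%N -> 0 < C ->
  \sum_(n.+1 <= k < T) raw c k
  <= h n + C * (eps (trunc_log 2 n) * theta ^- (trunc_log 2 n)).
Proof.
move=> cC n0 C0; have [Tn|nT] := leqP T n.+1.
  rewrite big_geq//; apply: addr_ge0; first exact/ltW/invscale_gt0.
  by rewrite pmulr_rge0// mulr_ge0 ?eps_ge0// invr_ge0 exprn_ge0// ltW.
case: T nT => // T nT; rewrite raw_tail_eq; last exact: ltnW.
apply: lerD.
  by rewrite gerBl ltW// invscale_gt0.
have [c0 cT] := cC; apply: le_trans (cT _ T.+1).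
rewrite [leRHS](@big_cat_nat _ _ _ n.+1)/=; last 2 first.
- by rewrite leqW// trunc_logP.
- exact: ltnW.
by apply: ler_wpDl => //; rewrite sumr_ge0.
Qed.

Lemma raw_sum_le c C (T : nat) : dyadic_small c C -> 0 < C ->
  \sum_(0 <= k < T) raw c k <= h 0 + C.
Proof.
move=> cC C0; case: T => [|T].
  by rewrite big_geq// addr_ge0// ltW// invscale_gt0.
rewrite big_ltn//= add0r raw_tail_eq//; apply: lerD.
  by rewrite gerBl ltW// invscale_gt0.
have [_ /(_ 0%N T.+1)] := cC; rewrite expn0 expr0 invr1 mulr1 => /le_trans; apply.
by rewrite ler_piMr ?eps_le1// ltW.
Qed.

Let rawp := raw (cluster theta).
Let rawn := raw (spike theta).

Let rawp_ge0 k : 0 <= rawp k.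
Proof. by have [C _ /raw_ge0] := cluster_small; exact. Qed.

Let rawn_ge0 k : 0 <= rawn k.
Proof. by have [C _ /raw_ge0] := spike_small; exact. Qed.

Definition total_weight : R := fine (\sum_(0 <= k <oo) (rawp k + rawn k)%:E)%E.

Local Notation total := total_weight.

Lemma total_series : (\sum_(0 <= k <oo) (rawp k + rawn k)%:E = total%:E)%E.
Proof.
rewrite /total fineK// ge0_fin_numE; last first.
  by apply: nneseries_ge0 => k _ _; rewrite lee_fin addr_ge0.
have [C C0 HC] := cluster_small; have [C' C'0 HC'] := spike_small.
apply: (@le_lt_trans _ _ (h 0 + C + (h 0 + C'))%:E); last exact: ltry.
apply: nneseries_le_ub => [k|T]; first by rewrite addr_ge0.
by rewrite big_split/=; apply: lerD; exact: raw_sum_le.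
Qed.

Lemma total_gt0 : 0 < total.
Proof.
have h01 : h 1 < h 0 by rewrite ltf_pV2 ?posrE ?scale_gt0// scale_lt// ltr01.
rewrite -lte_fin -total_series.
apply: lt_le_trans (nneseries_ge_partial 2 _); last by move=> k; rewrite addr_ge0.
rewrite lte_fin big_ltn// big_ltn// big_geq// addr0.
have : 0 < rawp 1.
  rewrite /rawp /=; apply: ltr_pwDl; first by rewrite subr_gt0.
  by have [C _ [c0 _]] := cluster_small; exact: c0.
by have := rawp_ge0 0; have := rawn_ge0 0; have := rawn_ge0 1; lra.
Qed.

Definition pos_weight k := rawp k / total.
Definition neg_weight k := rawn k / total.

Local Notation wpos := pos_weight.
Local Notation wneg := neg_weight.

Lemma wpos_ge0 k : 0 <= wpos k. Proof. by rewrite divr_ge0// ltW// total_gt0. Qed.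
Lemma wneg_ge0 k : 0 <= wneg k. Proof. by rewrite divr_ge0// ltW// total_gt0. Qed.

Lemma total_mass1 : (\sum_(0 <= k <oo) (wpos k + wneg k)%:E = 1)%E.
Proof.
transitivity (\sum_(0 <= k <oo) (total^-1%:E * (rawp k + rawn k)%:E))%E.
  by apply: eq_eseriesr => k _; rewrite -EFinM mulrC mulrDl.
rewrite nneseriesZl; last by move=> k _; rewrite lee_fin addr_ge0.
by rewrite total_series -EFinM mulVf// gt_eqF// total_gt0.
Qed.

Definition example_law : probability (measurableTypeR R) R :=
  discrete_law wpos_ge0 wneg_ge0.

Local Notation law := example_law.

Lemma law_right_tail (x : R) : 0 <= x ->
  (law `]x, +oo[%classic = \sum_(0 <= k <oo) (wpos k * (Num.truncn x < k)%N%:R)%:E)%E.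
Proof.
move=> x0; rewrite (discrete_law_measurableE wpos_ge0 wneg_ge0 total_mass1); last exact: measurable_itv.
apply: eq_eseriesr => k _; congr EFin.
rewrite [X in _ + X]mulrC [\1_ _ (- _)]indicE memNset ?mul0r ?addr0; last first.
  by rewrite /= in_itv/= andbT => xk; have : 0 <= k%:R :> R by []; lra.
by rewrite indicE; congr (_ * _%:R); rewrite truncn_lt_nat// mem_setE in_itv/= andbT.
Qed.

(** For x >= 1 this is the largest integer strictly below x: the left tail is taken over a closed
    half-line, so an atom at -x counts. *)
Definition left_index (x : R) : nat :=
  let q := Num.truncn x in if q%:R == x then q.-1 else q.

Lemma left_indexP (x : R) : 1 <= x -> forall k, (x <= k%:R) = (left_index x < k)%N.
Proof.
move=> x1 k; have x0 : 0 <= x by rewrite (le_trans ler01).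
rewrite /left_index; case: eqP => [qx|/eqP qx].
  have q0 : (0 < Num.truncn x)%N by rewrite truncn_gt0.
  by rewrite -{1}qx ler_nat prednK.
rewrite truncn_lt_nat// le_eqVlt; case: eqP => // xk; exfalso; move/eqP: qx; apply.
by rewrite xk truncnK.
Qed.

Lemma left_index_itv (x : R) : 1 <= x -> x - 1 <= (left_index x)%:R <= x.
Proof.
move=> x1; have x0 : 0 <= x by rewrite (le_trans ler01).
have H := left_indexP x1; apply/andP; split.
  by rewrite lerBlDr natr1 H.
by rewrite leNgt; apply/negP => /ltW; rewrite H ltnn.
Qed.

Lemma law_left_tail (x : R) : 1 <= x ->
  (law `]-oo, (- x)%R]%classic = \sum_(0 <= k <oo) (wneg k * (left_index x < k)%N%:R)%:E)%E.
Proof.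
move=> x1; rewrite (discrete_law_measurableE wpos_ge0 wneg_ge0 total_mass1); last exact: measurable_itv.
apply: eq_eseriesr => k _; congr EFin.
rewrite [X in X + _]mulrC [\1_ _ k%:R]indicE memNset ?mul0r ?add0r; last first.
  rewrite /= in_itv/= => kx; have : 0 <= k%:R :> R by [].
  by move: kx x1; lra.
by rewrite indicE; congr (_ * _%:R); rewrite -left_indexP// mem_setE in_itv/= lerN2.
Qed.

Lemma scale_le_pow2 (x : R) (M : nat) : 0 <= x -> x <= (2 ^ M)%:R -> scale x <= theta ^+ M.
Proof.
move=> x0 xM; apply: le_trans (scale_le_powR a_gt0 a_lt x0) _.
rewrite /two_pow -pow2_powR; apply: ge0_ler_powR; rewrite ?nnegrE ?(ltW a_gt0)//.
  by rewrite le_max ler01 orbT.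
by rewrite ge_max xM ler1n expn_gt0.
Qed.

Lemma invscale_pow2_le i : h (2 ^ i) <= 2 * theta^-1 ^+ i.
Proof.
apply: le_trans (invscale_le a_gt0 a_lt _) _; first by rewrite expn_gt0.
by rewrite pow2_powR powRN exprVn.
Qed.

(** For the lower bound, partial sums up to T are at least (h n - h T) / total by telescoping, and T
    = 2^i makes h T as small as desired. The upper bound holds for every partial sum. *)
Lemma tail_series_bounds c C (n : nat) : dyadic_small c C -> 0 < C -> (0 < n)%N ->
  let t := fine (\sum_(0 <= k <oo) (raw c k / total * (n < k)%N%:R)%:E)%E in
  h n / total <= t
  <= (h n + C * (eps (trunc_log 2 n) * theta ^- (trunc_log 2 n))) / total.
Proof.
move=> cC C0 n0 /=; pose B := (h n + C * (eps (trunc_log 2 n) * theta ^- (trunc_log 2 n))) / total.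
rewrite -/B.
have u0 k : 0 <= raw c k / total * (n < k)%N%:R.
  by rewrite mulr_ge0// divr_ge0 ?(raw_ge0 _ cC)// ltW// total_gt0.
have pE T : \sum_(0 <= k < T) raw c k / total * (n < k)%N%:R =
    (\sum_(n.+1 <= k < T) raw c k) / total.
  rewrite mulr_suml; have [Tn|nT] := leqP T n.+1.
    rewrite [RHS]big_geq// big_nat big1// => k /andP[_ kT].
    by rewrite ltnNge -ltnS (leq_trans kT Tn) mulr0.
  rewrite (@big_cat_nat _ _ _ n.+1)//=; last exact: ltnW.
  rewrite big_nat big1 ?add0r; last by move=> k /andP[_ kn]; rewrite ltnNge -ltnS kn mulr0.
  by rewrite big_nat [RHS]big_nat; apply: eq_bigr => k /andP[nk _]; rewrite nk mulr1.
have SB : (\sum_(0 <= k <oo) (raw c k / total * (n < k)%N%:R)%:E <= B%:E)%E.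
  apply: nneseries_le_ub => // T; rewrite pE ler_wpM2r ?invr_ge0 ?(ltW total_gt0)//.
  exact: raw_tail_le.
have S0 : (0 <= \sum_(0 <= k <oo) (raw c k / total * (n < k)%N%:R)%:E)%E.
  by apply: nneseries_ge0 => k _ _; rewrite lee_fin.
have Sfin : (\sum_(0 <= k <oo) (raw c k / total * (n < k)%N%:R)%:E \is a fin_num)%E.
  by rewrite ge0_fin_numE// (le_lt_trans SB)// ltry.
rewrite -!lee_fin fineK// SB andbT; apply/lee_addgt0Pr => e e0.
have [i hi] : exists i, 2 * theta^-1 ^+ i <= e * total.
  have /andP[q0 q1] := qth.
  have : theta^-1 ^+ i @[i --> \oo] --> (0 : R) by apply: cvg_expr; rewrite ger0_norm.
  move/cvgrPdist_le => /(_ (e * total / 2)); case; first by rewrite !mulr_gt0// total_gt0.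
  move=> i _ /(_ i (leqnn i))/=; rewrite sub0r normrN ger0_norm ?exprn_ge0// => H.
  by exists i; lra.
pose T := maxn n (2 ^ i).
have hT : h T <= e * total.
  apply: le_trans hi; apply: le_trans (invscale_pow2_le i).
  by rewrite lef_pV2 ?posrE ?scale_gt0// scale_le// ler_nat leq_maxr.
rewrite addeC -leeBlDl//.
apply: le_trans (nneseries_ge_partial T.+1 u0); rewrite pE -EFinB lee_fin.
rewrite raw_tail_eq ?leq_maxl// -[e]mulr1 -(divff (lt0r_neq0 total_gt0)) mulrA -mulrBl.
rewrite ler_wpM2r ?invr_ge0 ?(ltW total_gt0)//; apply: ler_wpDr.
  by apply: sumr_ge0 => k _; have [] := cC.
by rewrite lerB.
Qed.

(** With M the binary logarithm of [n x], x <= 2^(M+1) gives A(x) <= theta^(M+1). The perturbation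
    therefore adds at most C theta [eps M] to the ratio, which is squeezed to 1. *)
Lemma tail_asymp c C (n : R -> nat) : dyadic_small c C -> 0 < C ->
  (forall x, 1 <= x -> x - 1 <= (n x)%:R <= x) ->
  asymp_equiv
    (fun x => fine (\sum_(0 <= k <oo) (raw c k / total * (n x < k)%N%:R)%:E)%E)
    (fun x => total^-1 / scale x).
Proof.
move=> cC C0 nx; have L1 := scale_ratio_cvg a_gt0 a_lt nx.
have nx4 x : 1 <= x -> x - 1 <= 4 * (n x)%:R.
  by move=> /nx /andP[/le_trans + _]; apply; rewrite ler_peMl// ler1n.
have L2 := eps_trunc_log_cvg0 nx4.
have L3 : scale x * h (n x) + C * theta * eps (trunc_log 2 (n x)) @[x --> +oo] --> (1 : R).
  by rewrite -[X in _ --> X]addr0 -[X in 1 + X](mulr0 (C * theta)); apply: cvgD => //; exact: cvgMr.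
apply: (squeeze_cvgr _ L1 L3); near=> x.
have x2 : 2 <= x by near: x; apply: nbhs_pinfty_ge; exact: num_real.
have x0 : 0 <= x by lra.
have /andP[n1 n2] : x - 1 <= (n x)%:R <= x by apply: nx; lra.
have n0 : (0 < n x)%N by rewrite -(ltr_nat R); lra.
have /andP[t1 t2] := tail_series_bounds cC C0 n0.
have A0 : 0 < scale x by exact: scale_gt0.
have T0 := total_gt0.
set t := fine _ in t1 t2 *.
have -> : t / (total^-1 / scale x) = scale x * (t * total).
  by field; rewrite !gt_eqF.
rewrite ler_pM2l// -ler_pdivrMr// t1/=.
rewrite ler_pdivlMr// in t2.
apply: (le_trans (ler_wpM2l (ltW A0) t2)); rewrite mulrDr lerD2l.
set M := trunc_log 2 _.
have : scale x <= theta ^+ M.+1.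
  apply: scale_le_pow2 => //; apply: (@le_trans _ _ (n x).+1%:R); first by rewrite -natr1; lra.
  by rewrite ler_nat trunc_log_ltn.
rewrite exprS -ler_pdivrMr ?exprn_gt0// => H.
rewrite mulrCA -mulrA ler_wpM2l ?(ltW C0)// mulrCA mulrC ler_wpM2r ?eps_ge0//.
Unshelve. all: by end_near. Qed.

Lemma law_right_tail_asymp :
  asymp_equiv (fun x : R => fine (law `]x, +oo[%classic)) (fun x => total^-1 / scale x).
Proof.
have [C C0 HC] := cluster_small.
have nx (x : R) : 1 <= x -> x - 1 <= (Num.truncn x)%:R <= x.
  move=> x1; have /andP[q1 q2] := truncn_itv (le_trans ler01 x1).
  by rewrite q1 lerBlDr natr1 ltW.
have := tail_asymp HC C0 nx; apply: cvg_trans; apply: near_eq_cvg.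
by near=> x; rewrite law_right_tail.
Unshelve. all: by end_near. Qed.

Lemma law_left_tail_asymp :
  asymp_equiv (fun x : R => fine (law `]-oo, (- x)]%classic)) (fun x => total^-1 / scale x).
Proof.
have [C C0 HC] := spike_small.
have := tail_asymp HC C0 left_index_itv; apply: cvg_trans; apply: near_eq_cvg.
by near=> x; rewrite law_left_tail.
Unshelve. all: by end_near. Qed.

End law.

(** * The first integral *)

Section first_integral.
Context {R : realType} (a : R).
Hypothesis a_gt0 : 0 < a.
Hypothesis a_lt : a < 1 / 3.
Local Notation theta := (two_pow a).
Local Notation scale := (stable_scale a).
Local Notation kern := (power_kernel a).
Local Notation law := (example_law a_gt0 a_lt).
Local Notation total := (total_weight a).
Local Notation wpos := (pos_weight a).

Let theta_gt1 : 1 < theta := two_pow_gt1 a_gt0.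
Let theta3_lt2 : theta ^+ 3 < 2 := two_pow3_lt2 a_lt.
Let theta_gt0 : 0 < theta. Proof. exact: lt_trans theta_gt1. Qed.
Let total_gt0 : 0 < total := total_gt0 a_gt0 a_lt.

Let kern_cut (rho u : R) : R := if `|u| <= rho then kern u else 0.

Let kern_cut_ge0 rho u : 0 <= kern_cut rho u.
Proof. by rewrite /kern_cut; case: ifP => // _; exact: kern_ge0. Qed.

Let kern_cut_anti rho u v : `|u| <= `|v| -> kern_cut rho v <= kern_cut rho u.
Proof.
move=> uv; rewrite /kern_cut; case: ifPn => [v1|_]; last exact: kern_cut_ge0.
by rewrite (le_trans uv v1) kern_anti.
Qed.

Let kern_cut_le rho u : kern_cut rho u <= kern u.
Proof. by rewrite /kern_cut; case: ifP => // _; exact: kern_ge0. Qed.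

Let Cb : R := 2 * (2 `^ a^-1 - 1).

Let Cb_ge0 : 0 <= Cb.
Proof.
have := invscale_sub_le a_gt0 a_lt 0; rewrite powR1 mulr1 -/Cb; apply: le_trans.
by rewrite subr_ge0; exact: invscale_anti.
Qed.

(** After recentring, the cut leaves the integers below the first power of two above [rho], whose
    kernel sum is of order (theta^2)^i with 2^i <= rho. *)
Lemma sum_kern_cut (rho x : R) (T : nat) : 1 <= rho ->
  \sum_(k < T) kern_cut rho (k%:R - x)
  <= 2 * (kern 0 + (theta ^+ 2 - 1)^-1) * theta ^+ 2 * rho `^ (2 * a).
Proof.
move=> rho1; have rho0 : 0 <= rho by exact: le_trans rho1.
apply: le_trans; first by apply: sum_shift_le; [exact: kern_cut_ge0|exact: kern_cut_anti].
rewrite -[leRHS]mulrA -[leRHS]mulrA ler_wpM2l//.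
pose i := trunc_log 2 (Num.truncn rho).
have /andP[i1 i2] : (2 ^ i <= Num.truncn rho < 2 ^ i.+1)%N.
  by rewrite trunc_logP ?truncn_gt0// trunc_log_ltn.
have i3 : (2 ^ i)%:R <= rho by rewrite -truncn_ge_nat.
have i4 : rho < (2 ^ i.+1)%:R by rewrite -truncn_lt_nat.
apply: (@le_trans _ _ (\sum_(l < (2 ^ i.+1)%N) kern l%:R)).
  apply: (@le_trans _ _ (\sum_(l < T | (l < 2 ^ i.+1)%N) kern l%:R)).
    rewrite [leRHS]big_mkcond/=; apply: ler_sum => l _; rewrite /kern_cut ger0_norm//.
    case: ifP => [lr|_]; last by case: ifP => // _; exact: kern_ge0.
    by rewrite ifT// -(ltr_nat R) (le_lt_trans lr).
  rewrite -(big_mkord (fun l => l < 2 ^ i.+1)%N (fun l => kern l%:R)).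
  rewrite -(big_mkord xpredT (fun l => kern l%:R)).
  have [T1|T1] := leqP T (2 ^ i.+1).
    rewrite [leRHS](@big_cat_nat _ _ _ T)//=; apply: ler_wpDr.
      by apply: sumr_ge0 => l _; exact: kern_ge0.
    by rewrite big_mkcond; apply: ler_sum => l _; case: ifP => // _; exact: kern_ge0.
  rewrite (@big_cat_nat _ _ _ (2 ^ i.+1)%N)//=; last exact: ltnW.
  rewrite [X in _ + X]big_nat_cond [X in _ + X]big1 ?addr0; last first.
    by move=> l /andP[/andP[l1 _]]; rewrite ltnNge l1.
  by rewrite big_mkcond; apply: ler_sum => l _; case: ifP => // _; exact: kern_ge0.
apply: le_trans (sum_phi_pow2 theta_gt1 (@kern_ge0 _ a) (kern_anti a_lt) (@kern_pow2 _ a) _) _.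
apply: ler_wpM2l.
  by rewrite addr_ge0 ?kern_ge0// invr_ge0 subr_ge0 ltW// exprn_egt1.
rewrite mulnS exprD ler_wpM2l ?exprn_ge0 ?(ltW theta_gt0)//.
rewrite exprM; have -> : theta ^+ 2 = 2 `^ (2 * a).
  by rewrite (mulrC 2 a) powRrM powR_mulrn// powR_ge0.
by rewrite -pow2_powR; apply: ge0_ler_powR; rewrite ?nnegrE// mulr_ge0 ?(ltW a_gt0).
Qed.

(** The hypothesis keeps the window to the right of 2^M, so only blocks N >= M are met, and their
    bounds decay like (theta/2)^N. *)
Lemma cluster_kern_cut : exists2 C : R, 0 < C & forall rho x M T,
  (2 ^ M)%:R + rho <= x ->
  \sum_(0 <= k < T) cluster theta k * kern_cut rho (k%:R - x)
  <= C * (eps M * (theta / 2) ^+ M).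
Proof.
have [C C0 HC] := cluster_block_kernel theta_gt1 theta3_lt2 (@kern_ge0 _ a) (kern_anti a_lt)
  (@kern_pow2 _ a).
have q0 : 0 <= theta / 2 < 1.
  rewrite divr_ge0 ?(ltW theta_gt0)//= ltr_pdivrMr// mul1r.
  exact: theta_lt2.
have /andP[q1 q2] := q0.
exists (C / (1 - theta / 2)) => [|rho x M T Mx]; first by rewrite divr_gt0// subr_gt0.
pose w k := cluster theta k * kern_cut rho (k%:R - x).
have w0 k : 0 <= w k by rewrite mulr_ge0// cluster_ge0.
have wC j : \sum_(s < (2 ^ j)%N) w (2 ^ j + s)%N <= C * (eps j * (theta / 2) ^+ j).
  apply: le_trans (HC j (x - (2 ^ j)%:R)); apply: ler_sum => s _.
  rewrite ler_wpM2l ?cluster_ge0//; apply: le_trans (kern_cut_le _ _) _.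
  by rewrite natrD opprB addrA (addrC s%:R).
apply: le_trans (dyadic_tail M T w0 C0 q0 wC).
rewrite big_mkord -(big_mkord xpredT w).
have wz k : (k < 2 ^ M)%N -> w k = 0.
  move=> kM; rewrite /w /kern_cut ifF ?mulr0//; apply/negbTE; rewrite -ltNge.
  have : k%:R < (2 ^ M)%:R :> R by rewrite ltr_nat.
  by move=> kM'; rewrite ltr_normr; apply/orP; right; lra.
have [TM|MT] := leqP T (2 ^ M).
  rewrite [leRHS]big_geq// big_nat big1// => k /andP[_ kT].
  by rewrite wz// (leq_trans kT).
rewrite (@big_cat_nat _ _ _ (2 ^ M)%N)//=; last exact: ltnW.
by rewrite big_nat big1 ?add0r// => k /andP[_ /wz].
Qed.

(** On the window every k is at least x/2, so the regular part of the law has density O(x^(-a-1))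
    there. Multiplied by the kernel sum (delta x)^(2a), this is the first term; the clusters give
    the second. *)
Lemma I1tilde_le : exists2 C : R, 0 < C & forall delta x : R,
  0 < delta -> delta <= 1 / 2 -> 2 <= x -> 1 <= delta * x ->
  (I1tilde scale law delta x <=
   (C * (delta `^ (2 * a) * x `^ (a - 1) +
    eps (trunc_log 2 (Num.truncn x)).-1 * (theta / 2) ^+ (trunc_log 2 (Num.truncn x)).-1))%:E)%E.
Proof.
have [C C0 HC] := cluster_kern_cut.
pose C1 := 1 + (1 - 2 * a)^-1.
pose K2 := 2 * (kern 0 + (theta ^+ 2 - 1)^-1) * theta ^+ 2.
pose K1 := Cb * 2 `^ (a + 1) * K2.
have C10 : 0 < C1 by rewrite addr_gt0// invr_gt0; have := a_lt; lra.
have K20 : 0 <= K2.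
  apply: mulr_ge0; last exact/exprn_ge0/ltW.
  apply: mulr_ge0 => //; rewrite addr_ge0 ?kern_ge0// invr_ge0 subr_ge0 ltW//.
  by rewrite exprn_egt1.
have K10 : 0 <= K1 by rewrite mulr_ge0// mulr_ge0 ?powR_ge0.
have Z0 := total_gt0.
exists (C1 / total * (K1 + C)) => [|delta x d0 d1 x2 dx].
  by rewrite !mulr_gt0// ?invr_gt0// ltr_wpDl.
have x0 : 0 < x by exact: lt_le_trans x2.
pose rho := delta * x; have rhox : rho <= x / 2 by rewrite /rho ler_pdivlMr//; nra.
pose D : set R := [set w | `|w - x| <= rho].
have DE : D = `[x - rho, x + rho]%classic.
  by apply/seteqP; split => w; rewrite /D/= in_itv/= ler_distl.
have mD : measurable (D : set (measurableTypeR R)) by rewrite DE; exact: measurable_itv.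
pose g (w : R) := C1 * kern (w - x).
have g0 w : 0 <= g w by rewrite mulr_ge0 ?kern_ge0// ltW.
have mg : measurable_fun (D : set (measurableTypeR R)) (g : measurableTypeR R -> R).
  apply: measurable_funTS; apply: measurable_funM => //.
  apply: (@measurableT_comp _ _ _ _ _ _ (@powR R ^~ (2 * a - 1))) => //.
  apply: measurable_maxr => //; apply: (@measurableT_comp _ _ _ _ _ _ (@Num.norm R R)) => //.
  exact: measurable_funB.
apply: (@le_trans _ _ (\int[law]_(w in D) (g w)%:E)%E).
  apply: ge0_le_integral_nonmeas => [w _|w _|w].
  - by apply: integral_ge0 => t _; rewrite lee_fin b_scale_ge0.
  - by rewrite lee_fin.
  rewrite !patchE /D; case: ifPn => // _; exact: btilde2_le.
rewrite (integral_discrete_law (wpos_ge0 a_gt0 a_lt) (wneg_ge0 a_gt0 a_lt)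
  (total_mass1 a_gt0 a_lt) mD mg (fun w _ => g0 w)).
(* The window lies in [x/2, 3x/2], so the negative half-line, spikes included, is invisible to the
   first integral. *)
have nD k : \1_D (- k%:R) = 0 :> R.
  rewrite indicE memNset// /D/= => H; have : 0 <= k%:R :> R by [].
  by move: H; rewrite ler_norml; lra.
have gD k : \1_D k%:R * g k%:R = C1 * kern_cut rho (k%:R - x).
  rewrite indicE /g /kern_cut; have [kD|kD] := leP `|k%:R - x| rho.
    by rewrite mem_set// mul1r.
  by rewrite memNset ?mul0r ?mulr0//= => /(lt_le_trans kD); rewrite ltxx.
apply: nneseries_le_ub => [k|T].
  by rewrite nD mul0r mulr0 addr0 mulr_ge0 ?(wpos_ge0 a_gt0)// gD mulr_ge0// ltW.
(* One less than the logarithm of x, so that 2^M <= x/2 and the window of radius at most x/2 stays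
   beyond 2^M. *)
set M := (trunc_log 2 (Num.truncn x)).-1.
have t1 : (1 < Num.truncn x)%N by rewrite truncn_gt_nat// ltW.
have Mx : (2 ^ M)%:R + rho <= x.
  have ME : trunc_log 2 (Num.truncn x) = M.+1 by rewrite prednK// trunc_log_gt0.
  have : (2 ^ M.+1)%:R <= x :> R.
    by rewrite -truncn_ge_nat ?(ltW x0)// -ME trunc_logP// ltnW.
  by rewrite expnS natrM; lra.
pose G := Cb * (x / 2) `^ (- a - 1).
have G0 : 0 <= G by rewrite mulr_ge0 ?powR_ge0.
have term k : wpos k * (\1_D k%:R * g k%:R) + neg_weight a k * (\1_D (- k%:R) * g (- k%:R))
    <= C1 / total * (G * kern_cut rho (k%:R - x) + cluster theta k * kern_cut rho (k%:R - x)).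
  rewrite nD mul0r mulr0 addr0 gD /pos_weight.
  rewrite [leRHS](_ : _ = (G + cluster theta k) / total * (C1 * kern_cut rho (k%:R - x))); last by ring.
  have [kD|kD] := leP `|k%:R - x| rho; last first.
    by rewrite /kern_cut ifF ?mulr0//; apply/negbTE; rewrite -ltNge.
  apply: ler_wpM2r; first by rewrite mulr_ge0// ltW.
  rewrite ler_wpM2r ?invr_ge0 ?(ltW Z0)//.
  case: k kD => [|k] kD; first by rewrite addr_ge0// cluster_ge0.
  rewrite lerD2r; apply: le_trans (invscale_sub_le a_gt0 a_lt k) _.
  apply: ler_wpM2l; first exact: Cb_ge0.
  apply: powR_anti; [have := a_gt0; lra|by rewrite divr_gt0|].
  by move: kD; rewrite ler_norml; lra.
apply: (le_trans (ler_sum _ (fun k _ => term k))).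
rewrite -mulr_sumr -[leRHS]mulrA ler_wpM2l ?divr_ge0 ?(ltW C10) ?(ltW Z0)//.
rewrite big_split/= -mulr_sumr.
have S2 := HC rho x M T Mx.
have S1 : \sum_(0 <= k < T) kern_cut rho (k%:R - x) <= K2 * rho `^ (2 * a).
  by rewrite big_mkord; exact: sum_kern_cut.
have E : G * (K2 * rho `^ (2 * a)) = K1 * (delta `^ (2 * a) * x `^ (a - 1)).
  rewrite /G /K1 /rho !powRM ?invr_ge0 ?ltW//.
  have -> : 2^-1 `^ (- a - 1) = 2 `^ (a + 1).
    by rewrite -powR_inv1// -powRrM; congr (_ `^ _); ring.
  have -> : x `^ (a - 1) = x `^ (- a - 1) * x `^ (2 * a).
    rewrite -powRD; last by apply/implyP => _; rewrite gt_eqF.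
    by congr (_ `^ _); ring.
  ring.
set e := eps M * _ in S2 *; set d := delta `^ _ * _ in E *.
have e0 : 0 <= e by exact: eps_theta_ge0.
have d00 : 0 <= d by rewrite mulr_ge0 ?powR_ge0.
have := ler_wpM2l G0 S1; rewrite E => S1'.
apply: (le_trans (lerD S1' S2)); rewrite mulrDr.
by apply: lerD; rewrite ler_wpM2r// ?lerDl ?lerDr// ltW.
Qed.

Lemma I1tilde_an : is_an scale (I1tilde scale law).
Proof.
have [C C0 HC] := I1tilde_le.
pose n (x : R) := (2 ^ (trunc_log 2 (Num.truncn x)).-1)%N.
pose B := 4 * C.
have I1_ge0 delta x : (0 <= I1tilde scale law delta x)%E.
  apply: integral_ge0 => w _; apply: integral_ge0 => t _.
  by rewrite lee_fin b_scale_ge0.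
have A_ge (x : R) : 0 < x -> (scale x / x)^-1 <= 2 * x `^ (1 - a).
  move=> x0; have A0 : 0 < scale x by exact/scale_gt0/ltW.
  have -> : 2 * x `^ (1 - a) = (2^-1 * x `^ (a - 1))^-1.
    by rewrite invfM invrK -powRN opprB.
  rewrite lef_pV2 ?posrE; last 2 first.
  - exact: divr_gt0.
  - by rewrite mulr_gt0// powR_gt0.
  rewrite powRB ?powRr1 ?(ltW x0)//; last by apply/implyP => _; rewrite gt_eqF.
  rewrite mulrA; apply: ler_wpM2r; first by rewrite invr_ge0 ltW.
  exact/scale_ge_powR/ltW.
have lim delta : 0 < delta -> delta <= 1 / 2 ->
  (0 <= limf_esup (fun x => I1tilde scale law delta x * ((scale x / x)^-1)%:E)%E (pinfty_nbhs R)
   <= (B * delta `^ (2 * a))%:E)%E.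
  move=> d0 d1; have dp : 0 < delta `^ (2 * a) by rewrite powR_gt0.
  apply/andP; split.
    apply: limf_esup_pinfty_ge => M; exists (Num.max (M + 1) 1).
      by rewrite lt_max ltrDl ltr01.
    have m0 : 0 <= Num.max (M + 1) 1 by rewrite le_max ler01 orbT.
    by rewrite mule_ge0// lee_fin invr_ge0 divr_ge0// ltW// scale_gt0.
  apply: limf_esup_pinfty_le.
  have nx : forall x : R, 1 <= x -> x - 1 <= 4 * (n x)%:R.
    move=> x x1; have /andP[_ q2] := truncn_itv (le_trans ler01 x1).
    apply: (@le_trans _ _ (Num.truncn x)%:R); first by rewrite lerBlDr natr1 ltW.
    rewrite -natrM ler_nat; apply: (leq_trans (ltnW (trunc_log_ltn _ (ltnSn 1)))).
    by rewrite /n expnS; case: (trunc_log 2 _) => //= m; rewrite expnS; clear; lia.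
  have /cvgrPdist_le /(_ (delta `^ (2 * a) / 4)) E := eps_trunc_log_cvg0 nx.
  near=> x.
  have x2 : 2 <= x by near: x; apply: nbhs_pinfty_ge; exact: num_real.
  have x0 : 0 < x by exact: lt_le_trans x2.
  have dx : 1 <= delta * x.
    rewrite mulrC -ler_pdivrMr//; near: x; apply: nbhs_pinfty_ge; exact: num_real.
  pose M := (trunc_log 2 (Num.truncn x)).-1.
  have epsM : 4 * eps M <= delta `^ (2 * a).
    have : `|0 - eps (trunc_log 2 (n x))| <= delta `^ (2 * a) / 4.
      by near: x; apply: E; rewrite divr_gt0.
    by rewrite sub0r normrN ger0_norm ?eps_ge0// /n trunc_expnK// -/M; lra.
  apply: (@le_trans _ _ ((C * (delta `^ (2 * a) * x `^ (a - 1) + eps M * (theta / 2) ^+ M)) *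
     (2 * x `^ (1 - a)))%:E).
    rewrite [leRHS]EFinM; apply: lee_pmul => //; first by rewrite lee_fin invr_ge0 divr_ge0 ?ltW// scale_gt0// ltW.
      exact: HC.
    by rewrite lee_fin A_ge.
  rewrite lee_fin.
  have P1 : x `^ (a - 1) * x `^ (1 - a) = 1.
    rewrite -powRD; last by apply/implyP => _; rewrite gt_eqF.
    by rewrite addrA subrK subrr powRr0.
  (* Here x <= 2^(M+2) and 2^(1-a) = 2/theta, so the product is at most (2/theta)^2. The cluster
     term is thus at most 4 [eps M], which falls below delta^(2a) for large x: hence B = 4C. *)
  have P2 : (theta / 2) ^+ M * x `^ (1 - a) <= 4.
    have xM : x <= (2 ^ M.+2)%:R.
      have /andP[_ /ltW q2] := truncn_itv (ltW x0); apply: le_trans q2 _.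
      rewrite ler_nat; apply: (leq_trans (trunc_log_ltn _ (ltnSn 1))).
      by rewrite leq_exp2l// /M; case: (trunc_log _ _).
    have : x `^ (1 - a) <= (2 / theta) ^+ M.+2.
      have -> : 2 / theta = 2 `^ (1 - a).
        by rewrite powRB ?powRr1//; apply/implyP => _.
      rewrite -pow2_powR; apply: ge0_ler_powR; rewrite ?nnegrE ?(ltW x0)//.
      by have := a_lt; lra.
    move/(ler_wpM2l (exprn_ge0 M (divr_ge0 (ltW theta_gt0) (ler0n _ 2)))) => /le_trans; apply.
    rewrite -[M.+2]addn2 exprD mulrA -exprMn (_ : theta / 2 * (2 / theta) = 1); last first.
      by field; rewrite gt_eqF.
    rewrite expr1n mul1r expr2.
    have t2 : 2 / theta <= 2 by rewrite ler_piMr// invf_le1// ltW.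
    have t0 : 0 <= 2 / theta by rewrite divr_ge0// ltW.
    by nra.
  have P3 := ler_wpM2l (eps_ge0 M : 0 <= eps M :> R) P2.
  have -> : C * (delta `^ (2 * a) * x `^ (a - 1) + eps M * (theta / 2) ^+ M) * (2 * x `^ (1 - a))
   = 2 * C * (delta `^ (2 * a) * (x `^ (a - 1) * x `^ (1 - a)) + eps M * ((theta / 2) ^+ M * x `^ (1 - a))).
    by ring.
  rewrite P1 mulr1 /B (_ : 4 * C * _ = 2 * C * (delta `^ (2 * a) + delta `^ (2 * a))); last by ring.
  by rewrite ler_wpM2l ?mulr_ge0 ?(ltW C0)// lerD2l (le_trans P3)// mulrC.
have L : (B * delta `^ (2 * a))%:E @[delta --> 0^'+] --> 0%E.
  have L0 : B * delta `^ (2 * a) @[delta --> 0^'+] --> (0 : R).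
    by rewrite -[X in _ --> X](mulr0 B); apply: cvgMr; apply: powR_cvg0; rewrite mulr_gt0.
  by apply: cvg_EFin; [near=> x|exact: L0].
apply: squeeze_cvge (cvg_cst 0%E) L; near=> delta; apply: lim.
  near: delta; exact: nbhs_right_gt.
near: delta; apply: nbhs_right_le; lra.
Unshelve. all: by end_near. Qed.

End first_integral.

(** * The second integral *)

Section growth.
Context {R : realType}.

Lemma bernoulli_ge (d : R) (m : nat) : 0 <= d -> 1 + m%:R * d <= (1 + d) ^+ m.
Proof.
move=> d0; elim: m => [|m IH]; first by rewrite mul0r addr0 expr0.
rewrite exprS; have d1 : 0 <= 1 + d by lra.
apply: le_trans (ler_wpM2l d1 IH); rewrite -natr1.
have : 0 <= m%:R * (d * d) by rewrite !mulr_ge0.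
by lra.
Qed.

(** Taking n = 3m, Bernoulli gives q^n >= (d (m+1))^3, while (n+1)^2 <= 9 (m+1)^2; a cube beats a
    square once m+1 >= 9 |c| / d^3. The bound d <= 1 turns 1 + m d into d (m+1). *)
Lemma exp_beats_square (q c : R) (n0 : nat) : 1 < q ->
  exists2 n, (n0 <= n)%N & c * n.+1%:R ^+ 2 <= q ^+ n.
Proof.
move=> q1; pose d := Num.min (q - 1) 1.
have d0 : 0 < d by rewrite lt_min subr_gt0 q1/=.
have d1 : d <= 1 by rewrite ge_min lexx orbT.
have dq : 1 + d <= q by rewrite addrC -lerBrDr ge_min lexx.
pose m := maxn n0 (Num.truncn (9 * `|c| / d ^+ 3)).
have mc : 9 * `|c| / d ^+ 3 <= m.+1%:R.
  apply: (@le_trans _ _ (Num.truncn (9 * `|c| / d ^+ 3)).+1%:R); first exact/ltW/truncnS_gt.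
  by rewrite ler_nat ltnS leq_maxr.
exists (m * 3)%N; first by rewrite /m; lia.
rewrite exprM; have M0 : 0 < m.+1%:R :> R by [].
have B : d * m.+1%:R <= q ^+ m.
  apply: (@le_trans _ _ ((1 + d) ^+ m)); last by rewrite lerXn2r ?nnegrE; lra.
  by apply: le_trans (bernoulli_ge m (ltW d0)); rewrite -natr1; lra.
apply: (@le_trans _ _ ((d * m.+1%:R) ^+ 3)); last first.
  by rewrite lerXn2r ?nnegrE ?exprn_ge0 ?mulr_ge0 ?(ltW d0)//; lra.
rewrite ler_pdivrMr ?exprn_gt0// in mc.
apply: (@le_trans _ _ (`|c| * (3 * m.+1%:R) ^+ 2)).
  apply: le_trans (ler_wpM2r (exprn_ge0 2 (ler0n R _)) (ler_norm c)) _.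
  apply: ler_wpM2l => //.
  by rewrite lerXn2r ?nnegrE ?mulr_ge0// -natrM ler_nat; lia.
rewrite exprMn [(d * _) ^+ 3]exprMn.
have := ler_wpM2r (exprn_ge0 2 (ltW M0)) mc.
rewrite (exprS m.+1%:R 2) [3 ^+ 2](_ : _ = 9); last by ring.
lra.
Qed.

End growth.

(** Of the scales that carry clusters at N = 4^n, only the lower half is used: j < N - 2^n keeps the
    jump from 2^N to the cluster below any fixed fraction of 2^N once n is large. *)
Definition levels (n : nat) : seq nat := iota (4 ^ n - 2 ^ n.+1) (2 ^ n).

Lemma pow4_ge n : (2 <= n)%N -> (2 ^ n.+1 + 4 * n <= 4 ^ n)%N.
Proof.
elim: n => // n IH; rewrite leq_eqVlt => /predU1P[<- //|]; rewrite ltnS => /IH {}IH.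
rewrite !expnS in IH *; move: IH; have : (0 < 2 ^ n)%N by rewrite expn_gt0.
move: (2 ^ n)%N (4 ^ n)%N => p q; lia.
Qed.

Lemma levelsP n j : (2 <= n)%N -> j \in levels n ->
  [/\ (4 * n <= j)%N, (4 ^ n <= j + 2 ^ n.+1)%N & (j + 2 ^ n < 4 ^ n)%N].
Proof.
move=> n2; have := pow4_ge n2; rewrite mem_iota expnS.
have : (0 < 2 ^ n)%N by rewrite expn_gt0.
move: (2 ^ n)%N (4 ^ n)%N => p q; split; lia.
Qed.

Lemma levels_pow n j : (2 <= n)%N -> j \in levels n ->
  [/\ 2 ^ j = 2 * 2 ^ j.-1, 4 * 2 ^ (j - 3 * n) <= 2 ^ j.-1,
      2 ^ (j - 3 * n) * 2 ^ (3 * n) = 2 ^ j & 2 ^ j.+1 <= 2 ^ (4 ^ n)]%N.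
Proof.
move=> n2 jn; have [j1 j2 j3] := levelsP n2 jn; split.
- by rewrite -expnS prednK//; lia.
- by rewrite -(expnD 2 2) leq_exp2l//; lia.
- by rewrite -expnD subnK//; lia.
- by rewrite leq_exp2l//; have := expn_gt0 2 n; lia.
Qed.

Lemma levels_le n j : (2 <= n)%N -> j \in levels n ->
  (j <= 4 ^ n - 2 ^ n)%N /\ (4 ^ n = 4 ^ n - 2 ^ n + 2 ^ n)%N.
Proof. by move=> n2 jn; have [j1 j2 j3] := levelsP n2 jn; split; lia. Qed.

Section sites.
Context {R : realType} (a : R).
Hypothesis a_gt0 : 0 < a.
Hypothesis a_lt : a < 1 / 3.
Local Notation theta := (two_pow a).
Local Notation scale := (stable_scale a).
Local Notation law := (example_law a_gt0 a_lt).
Local Notation total := (total_weight a).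
Local Notation wpos := (pos_weight a).
Local Notation wneg := (neg_weight a).

Let theta_gt1 : 1 < theta := two_pow_gt1 a_gt0.
Let theta3_lt2 : theta ^+ 3 < 2 := two_pow3_lt2 a_lt.
Let theta_gt0 : 0 < theta. Proof. exact: lt_trans theta_gt1. Qed.
Let total_gt0 : 0 < total := total_gt0 a_gt0 a_lt.

Definition site_mass (n j : nat) : R :=
  n.+1%:R^-1 * (theta / 2) ^+ (4 ^ n) * theta ^- (2 * (j - 3 * n)) / total.

Definition spike_mass (n j : nat) : R := n.+1%:R^-1 * theta ^- j / total.

Lemma wpos_ge_site n j s : (2 <= n)%N -> j \in levels n ->
  (2 ^ j.-1 < s + 2 ^ (j - 3 * n))%N -> (s < 2 ^ j.-1 + 2 ^ (j - 3 * n))%N ->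
  site_mass n j <= wpos (2 ^ (4 ^ n) + (2 ^ j + s)).
Proof.
move=> n2 jn s1 s2; have [j1 j2 j3] := levelsP n2 jn.
rewrite /pos_weight ler_wpM2r ?invr_ge0 ?(ltW total_gt0)//.
have p0 : (0 < 2 ^ j)%N by rewrite expn_gt0.
rewrite -(@cluster_site R (two_pow a) theta_gt1 theta3_lt2 n j s) //; try lia.
case E : (2 ^ (4 ^ n) + (2 ^ j + s))%N => [|k]; first by lia.
by rewrite /= ler_wpDl// subr_ge0; exact: invscale_anti.
Qed.

Lemma wneg_ge_spike n j : (2 <= n)%N -> j \in levels n ->
  spike_mass n j <= wneg (2 ^ j + 2 ^ j.-1).
Proof.
move=> n2 jn; have [j1 j2 j3] := levelsP n2 jn.
rewrite /neg_weight ler_wpM2r ?invr_ge0 ?(ltW total_gt0)//.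
have p0 : (0 < 2 ^ j)%N by rewrite expn_gt0.
apply: (@le_trans _ _ (spike theta (2 ^ j + 2 ^ j.-1))).
  rewrite spike_site; last by lia.
  rewrite ler_wpM2r ?invr_ge0 ?exprn_ge0 ?(ltW theta_gt0)//.
  by rewrite -(eps_pow4 n); apply: eps_anti; lia.
case E : (2 ^ j + 2 ^ j.-1)%N => [|k]; first by lia.
by rewrite /= ler_wpDl// subr_ge0; exact: invscale_anti.
Qed.

Lemma scale_ratio_le (N : nat) : scale (2 ^ N)%:R / (2 ^ N)%:R <= (theta / 2) ^+ N.
Proof.
rewrite expr_div_n -natrX ler_wpM2r ?invr_ge0//.
exact: scale_le_pow2.
Qed.

Lemma site_mass_ge0 n j : 0 <= site_mass n j.
Proof.
rewrite /site_mass divr_ge0 ?(ltW total_gt0)//.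
apply: mulr_ge0; last by rewrite invr_ge0 exprn_ge0// ltW.
by rewrite mulr_ge0 ?invr_ge0// exprn_ge0// divr_ge0// ltW.
Qed.

Lemma spike_mass_ge0 n j : 0 <= spike_mass n j.
Proof.
rewrite /spike_mass divr_ge0 ?(ltW total_gt0)//.
by rewrite mulr_ge0 ?invr_ge0// exprn_ge0// ltW.
Qed.

(* The contribution of one scale does not depend on the scale: this is where
   the exponents of the cluster density and of the spikes come from. *)
Lemma level_value n j : (3 * n <= j)%N ->
  theta ^+ (3 * (j - 3 * n)) * (site_mass n j * spike_mass n j) =
  (theta / 2) ^+ (4 ^ n) * theta ^- (3 * n) / (n.+1%:R ^+ 2 * total ^+ 2).
Proof.
move=> nj; rewrite /site_mass /spike_mass; set i := (j - 3 * n)%N.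
have -> : theta ^- j = theta ^- i * theta ^- (3 * n).
  by rewrite -invfM -exprD subnK.
have -> : theta ^+ (3 * i) = theta ^+ (2 * i) * theta ^+ i.
  by rewrite -exprD; congr (_ ^+ _); lia.
have t k : theta ^+ k != 0 by rewrite expf_neq0// gt_eqF.
move: (t (2 * i)%N) (t i) (t (3 * n)%N).
move: (theta ^+ (2 * i)) (theta ^+ i) (theta ^+ (3 * n)) => x y z x0 y0 z0.
move: ((theta / 2) ^+ _) => w.
have n0 : n.+1%:R != 0 :> R by [].
have T0 : total != 0 by rewrite gt_eqF.
move: (n.+1%:R) (total) n0 T0 => p q p0 q0.
by field; rewrite x0 y0 z0 p0 q0.
Qed.

(** For each scale, 2^i sites (i = j - 3n) and one spike meet a kernel of at least (theta^3/2)^i /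
    32. The powers of 2 cancel, [level_value] makes the rest independent of j, and there are 2^n
    scales. *)
Lemma I2tilde_ge n (delta eta : R) : (2 <= n)%N -> 0 < eta ->
  1 <= eta * 2 ^+ (3 * n) -> 2 <= delta * 2 ^+ (2 ^ n) ->
  (((theta / 2) ^+ (4 ^ n) * (2 / theta ^+ 3) ^+ n / (32 * (n.+1%:R ^+ 2 * total ^+ 2)))%:E
   <= I2tilde scale law eta delta (2 ^ (4 ^ n))%:R)%E.
Proof.
move=> n2 eta0 hn dn.
set X := (2 ^ (4 ^ n))%N.
(* The right half of each cluster, centre included; l is the offset from the centre, and becomes the
   position y2 after the spike jump. *)
pose s := [seq (j, l) | j <- levels n, l <- iota 0 (2 ^ (j - 3 * n))].
pose pos (u : nat * nat) : nat := (2 ^ u.1 + (2 ^ u.1.-1 + u.2))%N.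
pose pt (u : nat * nat) : measurableTypeR R := (X + pos u)%:R.
pose d (j : nat) : R := 32^-1 * (theta ^+ 3 / 2) ^+ (j - 3 * n).
have d0 j : 0 <= d j by rewrite mulr_ge0// exprn_ge0// divr_ge0// exprn_ge0// ltW.
have sP u : u \in s -> [/\ u.1 \in levels n, (u.2 < 2 ^ (u.1 - 3 * n))%N & trunc_log 2 (pos u) = u.1].
  case/allpairsPdep => j [l [jn ll ->]] /=; move: ll; rewrite mem_iota add0n => /= ll.
  split => //; rewrite trunc_log_add//.
  have [-> j2 _ _] := levels_pow n2 jn; rewrite mul2n -addnn ltn_add2l.
  by apply: (leq_trans ll); apply: leq_trans j2; rewrite leq_pmull.
have us : uniq s.
  apply: allpairs_uniq_dep => [|j _|]; [exact: iota_uniq|exact: iota_uniq|].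
  by move=> [j l] [j' l'] _ _ [-> ->].
have inj : {in s &, injective pt}.
  move=> [j l] [j' l'] us1 us2 /eqP; rewrite eqr_nat eqn_add2l => /eqP e.
  have [_ _ /= t1] := sP _ us1; have [_ _ /= t2] := sP _ us2.
  have jj : j = j' by rewrite -t1 -t2 e.
  by move: e; rewrite /pos /= jj => /addnI /addnI ->.
apply: (@le_trans _ _ (\sum_(u <- s) (spike_mass n u.1 * d u.1) * site_mass n u.1)%:E); last first.
  apply: (@integral_ge_atoms _ _ _ law _ s pt) => //.
  - by move=> u; rewrite mulr_ge0 ?spike_mass_ge0.
  - move=> w _; apply: integral_ge0 => v _; apply: integral_ge0 => t _.
    by rewrite lee_fin b_scale_ge0.
  - move=> u us1; have [jn ul _] := sP _ us1; have [j1 j2 j3] := levelsP n2 jn.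
    set j := u.1 in jn ul j1 j2 j3 *.
    have y1E : pt u - X%:R = (pos u)%:R by rewrite /pt natrD addrC addKr.
    rewrite /= y1E.
    have posE : (pos u = 2 ^ j + (2 ^ j.-1 + u.2))%N by [].
    have [j_j i_j1 i_j jX] := levels_pow n2 jn; rewrite -/j in j_j i_j1 i_j jX.
    have {}i_j1 : (2 ^ (j - 3 * n) <= 2 ^ j.-1)%N by apply: leq_trans i_j1; rewrite leq_pmull.
    split.
      rewrite ger0_norm//; apply: (@le_trans _ _ (2 * 2 ^ j)%:R).
        rewrite ler_nat posE mul2n -addnn leq_add2l j_j mul2n -addnn leq_add2l.
        exact: leq_trans (ltnW ul) i_j1.
      have [jle nE] := levels_le n2 jn; rewrite -/j in jle.
      have -> : X = (2 ^ (4 ^ n - 2 ^ n) * 2 ^ (2 ^ n))%N by rewrite -expnD -nE.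
      rewrite !natrM !natrX mulrCA [leRHS]mulrC; apply: ler_pM => //.
      by apply: ler_weXn2l; [rewrite ler1n|exact: jle].
    have y1ge : (2 ^ j)%:R <= (pos u)%:R :> R by rewrite ler_nat posE leq_addr.
    have ulR : u.2%:R <= 2 ^+ (j - 3 * n) :> R by rewrite -natrX ler_nat ltnW.
    have y2E : - (2 ^ j + 2 ^ j.-1)%:R - - (pos u)%:R = u.2%:R :> R.
      by rewrite opprK posE addnA [(_ + u.2)%:R]natrD addKr.
    (* The inner integral is bounded below by its spike atom alone, as a family indexed by [tt]. *)
    rewrite mulrC -[X in (X%:E <= _)%E](big_seq1 +%R tt (fun=> d j * spike_mass n j)).
    apply: (@integral_ge_atoms _ _ _ law _ [:: tt]
      (fun=> - (2 ^ j + 2 ^ j.-1)%:R : measurableTypeR R) _ _ (fun=> d j) (fun=> spike_mass n j)) => //.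
    - by move=> [] [].
    - move=> w _; apply: integral_ge0 => t _.
      by rewrite lee_fin b_scale_ge0.
    - move=> _ _; rewrite /= y2E; split.
        rewrite !ger0_norm//; apply: le_trans ulR _.
        apply: (@le_trans _ _ (eta * (2 ^ j)%:R)); last by rewrite ler_wpM2l// ltW.
        by rewrite -i_j natrM !natrX mulrCA ler_peMr ?exprn_ge0.
      apply: btilde3_ge => //; first by rewrite ger0_norm.
      rewrite ger0_norm//; apply: le_trans y1ge; rewrite -natrX ler_nat expnS j_j.
      by rewrite leq_mul2l.
    - move=> _ _; apply: le_trans (discrete_law_neg_atom _ _ _ _); last exact: total_mass1.
      by rewrite lee_fin; exact: wneg_ge_spike.
  - move=> u us1; have [jn ul _] := sP _ us1.
    apply: le_trans (discrete_law_pos_atom _ _ _ _); last exact: total_mass1.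
    rewrite lee_fin; apply: wpos_ge_site => //; rewrite ?ltn_add2l//.
    by rewrite -addnA -[ltnLHS]addn0 ltn_add2l addn_gt0 expn_gt0 orbT.
rewrite lee_fin big_allpairs_dep/=.
rewrite (eq_big_seq (fun=> 32^-1 * ((theta / 2) ^+ (4 ^ n) * theta ^- (3 * n) /
  (n.+1%:R ^+ 2 * total ^+ 2)))); last first.
  move=> j jn; have [j1 _ _] := levelsP n2 jn.
  rewrite (_ : iota 0 _ = index_iota 0 (2 ^ (j - 3 * n))%N); last by rewrite /index_iota subn0.
  rewrite sumr_const_nat subn0 -(@level_value n j); last first.
    by rewrite (leq_trans _ j1)// leq_mul2r orbT.
  rewrite -[LHS]mulr_natr natrX /d expr_div_n -exprM.
  by field; rewrite expf_neq0.
rewrite big_const_seq count_predT size_iota iter_addr_0 -[leRHS]mulr_natr natrX.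
rewrite le_eqVlt; apply/orP; left; apply/eqP.
have -> : (2 / theta ^+ 3) ^+ n = 2 ^+ n / theta ^+ (3 * n).
  by rewrite expr_div_n -exprM.
have t0 : theta ^+ (3 * n) != 0 by rewrite expf_neq0// gt_eqF.
have p0 : n.+1%:R ^+ 2 * total ^+ 2 != 0 by rewrite mulf_neq0 ?expf_neq0 ?gt_eqF.
move: (theta ^+ (3 * n)) t0 (n.+1%:R ^+ 2 * total ^+ 2) p0 (_ ^+ (4 ^ n)) (2 ^+ n).
by move=> x x0 y y0 z t; field; rewrite x0 y0.
Qed.

End sites.

Section second_integral.
Context {R : realType} (a : R).
Hypothesis a_gt0 : 0 < a.
Hypothesis a_lt : a < 1 / 3.
Local Notation theta := (two_pow a).
Local Notation scale := (stable_scale a).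
Local Notation law := (example_law a_gt0 a_lt).
Local Notation total := (total_weight a).

Let theta_gt1 : 1 < theta := two_pow_gt1 a_gt0.
Let theta3_lt2 : theta ^+ 3 < 2 := two_pow3_lt2 a_lt.
Let theta_gt0 : 0 < theta. Proof. exact: lt_trans theta_gt1. Qed.
Let total_gt0 : 0 < total := total_gt0 a_gt0 a_lt.

Lemma exp2_ge (u : R) (n k : nat) : (Num.truncn u < n)%N -> (n <= k)%N -> u < 2 ^+ k.
Proof.
move=> un nk; apply: (@lt_le_trans _ _ n%:R); first by apply: (lt_le_trans (truncnS_gt u)); rewrite ler_nat.
by rewrite -natrX ler_nat (leq_trans nk)// ltnW// ltn_expl.
Qed.

Lemma ratio_gt1 : 1 < 2 / theta ^+ 3.
Proof. by rewrite ltr_pdivlMr ?exprn_gt0// mul1r. Qed.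

(** Since A(2^N) / 2^N <= (theta/2)^N, the division leaves at least (2/theta^3)^n / (n+1)^2. The
    same expression bounds the second integral and the potential from below. *)
Lemma unbounded_ratio (c B : R) (n0 : nat) : 0 < c ->
  exists2 n, (n0 <= n)%N &
    B <= c * ((theta / 2) ^+ (4 ^ n) * (2 / theta ^+ 3) ^+ n / n.+1%:R ^+ 2) *
         (scale (2 ^ (4 ^ n))%:R / (2 ^ (4 ^ n))%:R)^-1.
Proof.
move=> c0; have [n n0n nB] := exp_beats_square (`|B| / c) n0 ratio_gt1.
exists n => //; set r := _ / _ in nB *; set s := _ / (2 ^ (4 ^ n))%:R.
have s0 : 0 < s by rewrite divr_gt0 ?ltr0n ?expn_gt0//; exact: scale_gt0.
have sle : s <= (theta / 2) ^+ (4 ^ n) by exact: scale_ratio_le.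
apply: (le_trans (ler_norm B)); rewrite ler_pdivlMr//.
apply: (@le_trans _ _ (`|B| * (theta / 2) ^+ (4 ^ n))); first by rewrite ler_wpM2l.
rewrite mulrCA mulrC -mulrA ler_wpM2l//; first by rewrite exprn_ge0// divr_ge0// ltW.
rewrite mulrA ler_pdivlMr ?exprn_gt0//.
by rewrite mulrAC ler_pdivrMr// mulrC in nB.
Qed.

(** For each fixed delta, n can be taken beyond the thresholds set by delta and [eta], so the upper
    limit stays at least 1 however small delta is. *)
Lemma I2tilde_not_an (eta : R) : 0 < eta -> ~ is_an scale (I2tilde scale law eta).
Proof.
move=> eta0 an.
have big (delta : R) : 0 < delta -> (1 <= limf_esup (fun x =>
    I2tilde scale law eta delta x * ((scale x / x)^-1)%:E)%E (pinfty_nbhs R))%E.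
  move=> d0; apply: limf_esup_pinfty_ge => M.
  pose n0 := (2 + (Num.truncn eta^-1).+1 + (Num.truncn (2 / delta)).+1 + (Num.truncn M).+1)%N.
  have c0 : 0 < (32 * total ^+ 2)^-1 by rewrite invr_gt0 mulr_gt0// exprn_gt0.
  have [n nn0 nB] := unbounded_ratio 1 n0 c0.
  have [n2 n_eta n_delta n_M] : [/\ 2 <= n, Num.truncn eta^-1 < n,
      Num.truncn (2 / delta) < n & Num.truncn M < n]%N.
    move: nn0; rewrite /n0.
    move: (Num.truncn eta^-1) (Num.truncn (2 / delta)) (Num.truncn M) => x y z.
    by clear; split; lia.
  have H (k : nat) (u : R) : (Num.truncn u < n)%N -> (n <= k)%N -> u < 2 ^+ k by exact: exp2_ge.
  exists (2 ^ (4 ^ n))%:R.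
    by rewrite natrX; apply: H => //; rewrite ltnW// ltn_expl.
  set s := (_ / _)^-1 in nB *.
  have s0 : 0 <= s.
    by rewrite invr_ge0 divr_ge0// ltW//; exact: scale_gt0.
  have e1 : 1 <= eta * 2 ^+ (3 * n).
    by rewrite mulrC -ler_pdivrMr// mul1r ltW//; apply: H => //; rewrite leq_pmull.
  have e2 : 2 <= delta * 2 ^+ (2 ^ n).
    by rewrite mulrC -ler_pdivrMr// ltW//; apply: H => //; rewrite ltnW// ltn_expl.
  have := I2tilde_ge a_gt0 a_lt n2 eta0 e1 e2.
  set L := (X in (X%:E <= _)%E) => IL.
  apply: (@le_trans _ _ (L * s)%:E); last first.
    by rewrite EFinM lee_wpmul2r// lee_fin.
  rewrite lee_fin (le_trans nB)// le_eqVlt; apply/orP; left; apply/eqP; congr (_ * _).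
  rewrite /L -/theta; move: (_ ^+ (4 ^ n)) (_ ^+ n) => u v; field.
  by apply/andP; split; rewrite ?gt_eqF// addrC natr1.
suff : (1 <= 0 :> \bar R)%E by rewrite lee_fin ler10.
apply: (@cvge_to_ge _ _ _ _ _ _ _ an); near=> delta; apply: big.
near: delta; exact: nbhs_right_gt.
Unshelve. all: by end_near. Qed.

End second_integral.

(** * Failure of the strong renewal theorem *)

Section renewal.
Context {R : realType} (a : R).
Hypothesis a_gt0 : 0 < a.
Hypothesis a_lt : a < 1 / 3.
Local Notation theta := (two_pow a).
Local Notation scale := (stable_scale a).
Local Notation law := (example_law a_gt0 a_lt).
Local Notation total := (total_weight a).
Local Notation wpos := (pos_weight a).
Local Notation wneg := (neg_weight a).
Local Notation h := (invscale a).

Let theta_gt1 : 1 < theta := two_pow_gt1 a_gt0.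
Let theta3_lt2 : theta ^+ 3 < 2 := two_pow3_lt2 a_lt.
Let theta_gt0 : 0 < theta. Proof. exact: lt_trans theta_gt1. Qed.
Let total_gt0 : 0 < total := total_gt0 a_gt0 a_lt.
Let wpos_ge0 k : 0 <= wpos k := wpos_ge0 a_gt0 a_lt k.
Let wneg_ge0 k : 0 <= wneg k := wneg_ge0 a_gt0 a_lt k.

Definition mass (z : int) : R :=
  match z with Posz k => wpos k | Negz k => wneg k.+1 end.

(** As [Negz k] is -(k+1), the range is -T, ..., T-1, with 0 listed once. *)
Definition steps (T : nat) : seq int :=
  [seq Posz k | k <- iota 0 T] ++ [seq Negz k | k <- iota 0 T].

Lemma mass_ge0 z : 0 <= mass z. Proof. by case: z => k; rewrite /mass. Qed.

Lemma mass_le z : ((mass z)%:E <= law [set (z%:~R : R)])%E.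
Proof.
case: z => k; rewrite /mass.
  by apply: discrete_law_pos_atom; exact: total_mass1.
by rewrite NegzE mulrNz; apply: discrete_law_neg_atom; exact: total_mass1.
Qed.

Lemma uniq_steps T : uniq (steps T).
Proof.
rewrite cat_uniq !map_inj_uniq ?iota_uniq//=; try by move=> ? ? [].
by rewrite andbT; apply/hasPn => _ /mapP[k _ ->]; apply/negP => /mapP[].
Qed.

Lemma mem_steps T (z : int) : (`|z| < T)%N -> z \in steps T.
Proof.
rewrite mem_cat; case: z => k /= kT; apply/orP; [left|right].
  by apply: map_f; rewrite mem_iota.
by apply: map_f; rewrite mem_iota; move: kT; lia.
Qed.

Lemma sum_steps_trunc (T K : nat) (f : nat -> R) : (K < T)%N ->
  \sum_(z <- steps T) (if (`|z| <= K)%N then mass z else 0) * f `|z|%N =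
  \sum_(0 <= k < K.+1) (wpos k + wneg k) * f k.
Proof.
move=> KT; rewrite big_cat !big_map/= -{1 2}(subn0 T) -/(index_iota 0 T).
under [RHS]eq_bigr do rewrite mulrDl.
rewrite big_split/=; congr (_ + _).
  rewrite (@big_cat_nat _ _ _ K.+1)//= [X in _ + X]big_nat [X in _ + X]big1 ?addr0.
    by rewrite big_nat [RHS]big_nat; apply: eq_bigr => k /andP[_ kK]; rewrite ifT.
  by move=> k /andP[kK _]; rewrite leqNgt kK mul0r.
have w0 : wneg 0 = 0 by rewrite /neg_weight /= mul0r.
rewrite [RHS]big_ltn// w0 mul0r add0r big_add1/=.
rewrite (@big_cat_nat _ _ _ K)//= 1?ltnW// [X in _ + X]big_nat [X in _ + X]big1 ?addr0.
  by rewrite big_nat [RHS]big_nat; apply: eq_bigr => k /andP[_ kK]; rewrite ifT.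
by move=> k /andP[kK _]; rewrite ltnNge kK mul0r.
Qed.

Let Cb : R := 2 * (2 `^ a^-1 - 1).

Let Cb_ge0 : 0 <= Cb.
Proof.
have := invscale_sub_le a_gt0 a_lt 0; rewrite powR1 mulr1; apply: le_trans.
by rewrite subr_ge0; exact: invscale_anti.
Qed.

Lemma raw_block c C j : dyadic_small a c C -> 0 < C ->
  \sum_(s < (2 ^ j)%N) raw a c (2 ^ j + s)%N <= (Cb + C) * theta^-1 ^+ j.
Proof.
move=> [c0 cC] C0.
have base (s : nat) : raw a c (2 ^ j + s)%N <= Cb * (2 ^ j)%:R `^ (- a - 1) + c (2 ^ j + s)%N.
  case E : (2 ^ j + s)%N => [|k]; first by have := expn_gt0 2 j; lia.
  rewrite /= lerD2r; apply: le_trans (invscale_sub_le a_gt0 a_lt k) _.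
  apply: ler_wpM2l => //; apply: powR_anti.
  - by have := a_gt0; lra.
  - by rewrite ltr0n expn_gt0.
  - by rewrite ler_nat -E leq_addr.
apply: (@le_trans _ _ (\sum_(s < (2 ^ j)%N) (Cb * (2 ^ j)%:R `^ (- a - 1) + c (2 ^ j + s)%N))).
  by apply: ler_sum => s _; exact: base.
rewrite big_split/= mulrDl; apply: lerD.
  rewrite sumr_const card_ord -[leLHS]mulr_natr -mulrA le_eqVlt; apply/orP; left; apply/eqP.
  congr (_ * _); rewrite pow2_powR.
  have -> : 2 `^ (- a - 1) = theta^-1 / 2 by rewrite powRB ?powRr1 ?powRN//; apply/implyP.
  by rewrite expr_div_n natrX mulfVK// expf_neq0.
have -> : \sum_(s < (2 ^ j)%N) c (2 ^ j + s)%N = \sum_((2 ^ j)%N <= k < (2 ^ j.+1)%N) c k.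
  rewrite -(big_mkord xpredT (fun s => c (2 ^ j + s)%N)) expnS mul2n -addnn.
  rewrite -[in RHS](add0n (2 ^ j)%N) -[in X in _ = \sum_(_ <= k < X) _](add0n (2 ^ j)%N) addnA.
  by rewrite big_addn addnK addn0; apply: eq_bigr => s _; rewrite addnC.
move: (cC j (2 ^ j.+1)%N) => /le_trans; apply; rewrite ler_wpM2l ?(ltW C0)// exprVn.
by rewrite ler_piMl ?eps_le1// invr_ge0 exprn_ge0// ltW.
Qed.

(** Block masses decay like theta^(-j), and theta < 2 makes the last block dominate the first moment
    up to 2^i. Hence order theta^i steps truncated at 2^i lose little mass and move by at most order
    2^i. *)
Lemma truncated_moments : exists2 C : R, 0 < C & forall i : nat,
  [/\ 1 - C * theta^-1 ^+ i <= \sum_(0 <= k < (2 ^ i).+1) (wpos k + wneg k),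
      \sum_(0 <= k < (2 ^ i).+1) (wpos k + wneg k) <= 1
    & \sum_(0 <= k < (2 ^ i).+1) (wpos k + wneg k) * k%:R <= C * theta^-1 ^+ i * 2 ^+ i].
Proof.
have [C1 C10 HC1] := cluster_small a_gt0 a_lt.
have [C2 C20 HC2] := spike_small a_gt0.
pose W k := wpos k + wneg k.
have W0 k : 0 <= W k by rewrite addr_ge0.
pose B := 2 * (2 * Cb + C1 + C2) / total.
have B0 : 0 <= B.
  by rewrite divr_ge0 ?(ltW total_gt0)//; have := Cb_ge0; lra.
pose q := 2 / theta; have q1 : 1 < q by rewrite ltr_pdivlMr// mul1r theta_lt2.
have q0 : 0 < q by exact: lt_trans q1.
have Bq0 : 0 <= B * q / (q - 1).
  by apply: divr_ge0; [rewrite mulr_ge0// ltW|rewrite subr_ge0 ltW].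
pose C0 := (4 + C1 + C2) / total.
have C00 : 0 < C0 by rewrite divr_gt0//; lra.
exists (C0 + B * q / (q - 1)) => [|i]; first by rewrite ltr_pwDl.
have t0 : 0 <= theta^-1 ^+ i by rewrite exprn_ge0// invr_ge0 ltW.
set S := \sum_(0 <= k < _) (wpos k + wneg k).
split.
- suff : 1 <= S + C0 * theta^-1 ^+ i.
    by have := mulr_ge0 Bq0 t0; rewrite mulrDl; lra.
  rewrite -lee_fin -(total_mass1 a_gt0 a_lt); apply: (nneseries_le_ub (u := W)) => // T.
  have [TK|KT] := leqP T (2 ^ i).+1.
    apply: ler_wpDr; first by rewrite mulr_ge0// ltW.
    rewrite /S [leRHS](@big_cat_nat _ _ _ T)//=; apply: ler_wpDr => //.
    by apply: sumr_ge0 => k _; exact: W0.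
  rewrite (@big_cat_nat _ _ _ (2 ^ i).+1)//=; last exact: ltnW.
  rewrite lerD2l.
  have tail c C : dyadic_small a c C -> 0 < C ->
      \sum_((2 ^ i).+1 <= k < T) raw a c k / total <= (2 + C) / total * theta^-1 ^+ i.
    move=> cC Cp; rewrite -mulr_suml mulrAC ler_wpM2r ?invr_ge0 ?(ltW total_gt0)//.
    apply: (le_trans (raw_tail_le a_gt0 a_lt T cC _ Cp)); first by rewrite expn_gt0.
    rewrite trunc_expnK// mulrDl; apply: lerD; first exact: invscale_pow2_le.
    by rewrite exprVn ler_wpM2l ?(ltW Cp)// ler_piMl ?eps_le1// -exprVn.
  rewrite /W big_split/=; apply: (le_trans (lerD (tail _ _ HC1 C10) (tail _ _ HC2 C20))).
  by rewrite -mulrDl /C0 le_eqVlt; apply/orP; left; apply/eqP; congr (_ * _); field; rewrite gt_eqF.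
- by rewrite -lee_fin -(total_mass1 a_gt0 a_lt); exact: nneseries_ge_partial.
apply: (@le_trans _ _ (\sum_(1 <= k < (2 ^ i.+1)%N) W k * k%:R)).
  rewrite big_ltn// mulr0 add0r.
  have hK : ((2 ^ i).+1 <= 2 ^ i.+1)%N by rewrite expnS mul2n -addnn -addn1 leq_add2l expn_gt0.
  rewrite [leRHS](@big_cat_nat _ _ _ (2 ^ i).+1)//=; apply: ler_wpDr => //.
  by apply: sumr_ge0 => k _; rewrite mulr_ge0.
rewrite (dyadic_sum (fun k => W k * k%:R)).
apply: (@le_trans _ _ (\sum_(j < i.+1) B * q ^+ j)).
  apply: ler_sum => j _.
  apply: (@le_trans _ _ (\sum_(s < (2 ^ j)%N) W (2 ^ j + s)%N * (2 * 2 ^+ j))).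
    apply: ler_sum => s _; rewrite ler_wpM2l// -natrX -natrM ler_nat.
    by rewrite mul2n -addnn leq_add2l ltnW.
  rewrite -mulr_suml big_split/= -!mulr_suml.
  have b1 := raw_block j HC1 C10; have b2 := raw_block j HC2 C20.
  set x := \sum_(_ < _) _ in b1 *; set y := \sum_(_ < _) _ in b2 *.
  have -> : B * q ^+ j = ((Cb + C1) * theta^-1 ^+ j + (Cb + C2) * theta^-1 ^+ j) / total * (2 * 2 ^+ j).
    rewrite /B /q expr_div_n exprVn; field.
    by rewrite expf_neq0 ?gt_eqF.
  rewrite -mulrDl; apply: ler_wpM2r; first by rewrite mulr_ge0// exprn_ge0.
  apply: ler_wpM2r; first by rewrite invr_ge0 ltW.
  exact: lerD.
rewrite -mulr_sumr; have gs := ler_wpM2l B0 (geom_sum_gt1 i.+1 q1).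
apply: (le_trans gs).
have -> : B * (q ^+ i.+1 / (q - 1)) = B * q / (q - 1) * theta^-1 ^+ i * 2 ^+ i.
  by rewrite -mulrA -exprMn (mulrC _ 2) -/q exprS; field; rewrite subr_eq0 gt_eqF.
rewrite ler_wpM2r ?exprn_ge0// ler_wpM2r// lerDr ltW//.
Qed.

Lemma step_op_ge1 (S : seq int) (c g : int -> R) (i y : int) : uniq S -> i \in S ->
  (forall z, 0 <= c z) -> (forall z, 0 <= g z) -> c i * g (y + i) <= step_op S c g y.
Proof.
move=> uS iS c0 g0; rewrite /step_op (bigD1_seq i)//= lerDl.
by apply: sumr_ge0 => z _; rewrite mulr_ge0.
Qed.

Lemma sum_le1_seq (r : seq nat) (f : nat -> R) (j0 : nat) (B : R) : uniq r -> 0 <= B ->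
  (forall j, j \in r -> f j <= if j == j0 then B else 0) -> \sum_(j <- r) f j <= B.
Proof.
move=> ur B0 fB; rewrite big_seq; apply: le_trans (ler_sum _ fB) _; rewrite -big_seq.
have [j0r|j0r] := boolP (j0 \in r).
  by rewrite (bigD1_seq j0)//= eqxx big1 ?addr0// => j /negbTE ->.
rewrite big_seq big1// => j jr; case: eqP => // jj0.
by rewrite -jj0 jr in j0r.
Qed.

Let center (j : nat) : nat := (2 ^ j + 2 ^ j.-1)%N.

(** Each scale offers [m j]^3 choices of run lengths, each of probability at least half of site mass
    times spike mass. As [m j] is at least theta^(j-3n) / (24 C), [level_value] applies again, and
    the constant collects (24 C)^3, the factor 2 and [total]^2. *)
Lemma potential_ge : exists2 c : R, 0 < c & exists n0 : nat, forall n, (n0 <= n)%N ->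
  exists S M, uniq S /\
    c * ((theta / 2) ^+ (4 ^ n) * (2 / theta ^+ 3) ^+ n / n.+1%:R ^+ 2)
    <= potential S mass M (fun z => (z == (2 ^ (4 ^ n))%:Z)%:R) 0.
Proof.
have [C C0 HC] := truncated_moments.
exists ((2 * (24 * C) ^+ 3 * total ^+ 2)^-1).
  by rewrite invr_gt0 !mulr_gt0// exprn_gt0// mulr_gt0.
pose d := theta - 1; have d0 : 0 < d by rewrite subr_gt0.
exists (2 + (Num.truncn (12 * C / d)).+1)%N => n n0n.
have n2 : (2 <= n)%N by move: n0n; lia.
have nC : 12 * C <= theta ^+ n.
  apply: (@le_trans _ _ (1 + n%:R * d)); last first.
    by have := bernoulli_ge n (ltW d0); rewrite (_ : 1 + d = theta)// /d addrC subrK.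
  apply: ler_wpDl => //; rewrite -ler_pdivrMr//.
  apply: (le_trans (ltW (truncnS_gt _))); rewrite ler_nat; move: n0n.
  by move: (Num.truncn _) => t; lia.
set X := (2 ^ (4 ^ n))%N.
pose S := steps (2 * X); pose L := Num.truncn (theta ^+ (4 ^ n) / (12 * C)).
exists S, (L + (L + L))%N; split; first exact: uniq_steps.
pose K j := (2 ^ (j - 3 * n))%N.
pose u (z : int) := if (`|z| <= X)%N then mass z else 0.
pose uj j (z : int) := if (`|z| <= K j)%N then mass z else 0.
pose v j (z : int) := if (`|(z - (X + center j)%:Z)%R| < K j)%N then mass z else 0.
pose w j (z : int) := if z == - (center j)%:Z then mass z else 0.
(* With fewer than 3 [m j] small steps, the lost mass and the Markov bound on the displacement are
   each at most 1/4; this fixes the 12 and leaves probability 1/2. *)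
pose m j := Num.truncn (theta ^+ (j - 3 * n) / (12 * C)).
pose g (z : int) : R := (z == X%:Z)%:R.
have g0 z : 0 <= g z by [].
have mass0 := mass_ge0.
have u0 z : 0 <= u z by rewrite /u; case: ifP.
have uj0 j z : 0 <= uj j z by rewrite /uj; case: ifP.
have v0 j z : 0 <= v j z by rewrite /v; case: ifP.
have w0 j z : 0 <= w j z by rewrite /w; case: ifP.
have lev_S j : j \in levels n ->
    [/\ (center j < 2 * X)%N, (K j < center j)%N, (K j < X)%N & (K j <= 2 ^ j.-1)%N].
  move=> jn; have [e1 e2 _ e4] := levels_pow n2 jn.
  have Kp : (0 < K j)%N by rewrite expn_gt0.
  have Xp : (0 < X)%N by rewrite expn_gt0.
  move: e1 e2 e4 Kp Xp; rewrite /center -/(K j) -/X expnS; clear.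
  move: (2 ^ j)%N (2 ^ j.-1)%N (K j) X => p q k x; split; lia.
have term j y : j \in levels n -> (y < 3 * m j)%N ->
    site_mass a n j * spike_mass a n j / 2 <=
    iter y (step_op S (uj j)) (step_op S (v j) (step_op S (w j) g)) 0.
  move=> jn ym; have [cX Kc KX Kj] := lev_S _ jn.
  have [e1 e2 _ e4] := levels_pow n2 jn; rewrite -/(K j) -/X in e2 e4.
  set i := (j - 3 * n)%N; have [M1 M2 M3] := HC i.
  set tau := C * theta^-1 ^+ i in M1 M3.
  set D := site_mass a n j * spike_mass a n j.
  have D0 : 0 <= D by rewrite mulr_ge0 ?site_mass_ge0 ?spike_mass_ge0.
  have tau0 : 0 <= tau by rewrite mulr_ge0 ?(ltW C0)// exprn_ge0// invr_ge0 ltW.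
  have KT : (K j < 2 * X)%N by rewrite (leq_trans KX)// leq_pmull.
  have K0 : 0 < 2 ^+ i :> R by rewrite exprn_gt0.
  have ytau : y%:R * tau <= 1 / 4.
    have ty : 0 < theta ^+ i by rewrite exprn_gt0.
    have mi : (m j)%:R <= theta ^+ i / (12 * C).
      by rewrite truncn_le// divr_ge0 ?(ltW ty)// mulr_ge0// ltW.
    have yR : y%:R <= 3 * (theta ^+ i / (12 * C)).
      apply: (@le_trans _ _ (3 * (m j)%:R)); last by rewrite ler_wpM2l.
      by rewrite -natrM ler_nat ltnW.
    apply: le_trans (ler_wpM2r tau0 yR) _; rewrite le_eqVlt; apply/orP; left; apply/eqP.
    by rewrite /tau exprVn; field; rewrite !gt_eqF.
  have S1 f : \sum_(z <- S) uj j z * f `|z|%N = \sum_(0 <= k < (2 ^ i).+1) (wpos k + wneg k) * f k.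
    exact: sum_steps_trunc.
  apply: le_trans (@iter_step_op_ge R S (uj j) _ D (2 ^+ i) tau (tau * 2 ^+ i) y 0
    (uj0 j) D0 K0 tau0 _ _ _ _).
  - rewrite normr0 add0r mulrA mulfK ?gt_eqF// ler_wpM2l//; lra.
  - by rewrite mulr_ge0// ltW.
  - have := S1 (fun=> 1); under eq_bigr do rewrite mulr1.
    by under [RHS]eq_bigr do rewrite mulr1; move=> ->; rewrite M1 M2.
  - by have := S1 (fun k => k%:R) => ->.
  (* Beyond K j the claimed lower bound is at most 0. Within it, the total displacement [z] of the
     small steps is undone by jumping to the cluster site at offset -z from the centre, after which
     the spike jump lands exactly on X. *)
  move=> z; have [zK|Kz] := ltnP `|z| (K j); last first.
    apply: (@le_trans _ _ 0); last by apply: step_op_ge0 => // ?; exact: step_op_ge0.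
    rewrite mulr_ge0_le0// subr_le0 ler_pdivlMr// mul1r -natrX -/(K j).
    by rewrite -abszE -pmulrn ler_nat.
  have [s sE] : exists s : nat, s%:Z = (2 ^ j.-1)%N%:Z - z.
    exists `|(2 ^ j.-1)%N%:Z - z|%N; move: Kj zK; clear.
    by move: (2 ^ j.-1)%N (K j) => p k; lia.
  have [s1 s2] : (2 ^ j.-1 < s + K j)%N /\ (s < 2 ^ j.-1 + K j)%N.
    move: sE zK; clear; move: (2 ^ j.-1)%N (K j) => p k; split; lia.
  have z1E : z + (X + (2 ^ j + s))%N%:Z = (X + center j)%N%:Z.
    move: sE; rewrite /center; clear; move: (2 ^ j)%N (2 ^ j.-1)%N X => p q x; lia.
  have z1S : (X + (2 ^ j + s))%N%:Z \in S.
    apply: mem_steps; rewrite absz_nat mul2n -addnn ltn_add2l.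
    move: s2 e1 e2 e4 Kj; rewrite expnS; clear.
    by move: (2 ^ j)%N (2 ^ j.-1)%N (K j) X => p q k x; lia.
  have cS : - (center j)%N%:Z \in S by apply: mem_steps; rewrite abszN absz_nat.
  have uS := uniq_steps (2 * X).
  apply: le_trans (@step_op_ge1 S (v j) (step_op S (w j) g) _ z uS z1S (v0 j)
    (step_op_ge0 S (w0 j) g0)).
  apply: (@le_trans _ _ D).
    by rewrite ler_piMr// gerBl divr_ge0 ?(ltW K0)// ler0z.
  apply: ler_pM; rewrite ?site_mass_ge0 ?spike_mass_ge0//.
    rewrite /v ifT; first by rewrite /mass wpos_ge_site.
    move: z1E zK; clear; move: (X + (2 ^ j + s))%N (X + center j)%N (K j) => p q k; lia.
  rewrite z1E; apply: le_trans (@step_op_ge1 S (w j) g _ _ uS cS (w0 j) g0).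
  rewrite /w eqxx /g PoszD addrK eqxx mulr1.
  have : (0 < center j)%N by exact: leq_ltn_trans Kc.
  case E : (center j) => [//|c] _; rewrite -NegzE /mass -E.
  exact: wneg_ge_spike.
(* Disjointness of the scenarios: [u] stops at X, cluster jumps are longer than X, and the dyadic
   block of |z| - X determines j. *)
have H1 z : u z + \sum_(j <- levels n) v j z <= mass z.
  have vX j : j \in levels n -> (`|(z - (X + center j)%N%:Z)%R| < K j)%N ->
      (X < `|z|)%N /\ j = trunc_log 2 (`|z| - X).
    move=> jn; have [_ _ _ Kj] := lev_S _ jn; have [e1 e2 _ e4] := levels_pow n2 jn.
    have p0 : (0 < 2 ^ j.-1)%N by rewrite expn_gt0.
    move: e2; rewrite -/(K j) => e2 zK.
    have [x1 [x2 x3]] : (X < `|z|)%N /\ (2 ^ j <= `|z| - X)%N /\ (`|z| - X < 2 ^ j.+1)%N.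
      move: e1 e2 zK p0; rewrite expnS /center; clear.
      by move: (2 ^ j)%N (2 ^ j.-1)%N (K j) X => p q k x; split; [lia|split; lia].
    by split=> //; apply/esym/trunc_log_eq => //; rewrite x2 x3.
  have [zX|Xz] := leqP `|z| X.
    rewrite /u zX big_seq big1 ?addr0// => j jn; rewrite /v; case: ifPn => // /(vX j jn)[].
    by rewrite ltnNge zX.
  rewrite /u leqNgt Xz add0r.
  apply: (@sum_le1_seq _ _ (trunc_log 2 (`|z| - X))); [exact: iota_uniq|by []|].
  by move=> j jn; rewrite /v; case: ifPn => [/(vX j jn)[_ <-]|_]; rewrite ?eqxx//; case: ifP.
have H2 j z : j \in levels n -> uj j z <= u z.
  move=> /lev_S[_ _ KX _]; rewrite /uj /u; case: ifPn => [zK|_]; last by case: ifP.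
  by rewrite ifT// (leq_trans zK)// ltnW.
have H3 j z : j \in levels n -> uj j z + w j z <= mass z.
  move=> /lev_S[_ Kc _ _]; rewrite /uj /w; case: eqP => [->|_].
    by rewrite abszN absz_nat leqNgt Kc add0r.
  by rewrite addr0; case: ifP.
have H4 j : j \in levels n -> (m j <= L)%N.
  move=> jn; apply: le_truncn; rewrite ler_wpM2r ?invr_ge0 ?mulr_ge0 ?(ltW C0)//.
  have [_ _ j3] := levelsP n2 jn.
  apply: ler_weXn2l; first exact: ltW.
  by apply: leq_trans (leq_subr _ _) _; apply: leq_trans (ltnW j3); rewrite leq_addr.
apply: le_trans (@potential_two_steps R S (levels n) mass u uj v w m L g 0 u0 g0 uj0 v0 w0 H1 H2 H3 H4).
apply: (@le_trans _ _ (\sum_(j <- levels n) (m j)%:R ^+ 3 * (site_mass a n j * spike_mass a n j / 2))); last first.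
  rewrite big_seq [leRHS]big_seq; apply: ler_sum => j jn.
  rewrite (_ : (m j)%:R ^+ 3 * _ = \sum_(x < m j) \sum_(y < m j) \sum_(z < m j)
     (site_mass a n j * spike_mass a n j / 2)); last first.
    rewrite !sumr_const !card_ord -!mulrnA mulrC -[RHS]mulr_natr; congr (_ * _).
    by rewrite !natrM; ring.
  apply: ler_sum => x _; apply: ler_sum => y _; apply: ler_sum => z _; apply: term => //.
  have := ltn_ord x; have := ltn_ord y; have := ltn_ord z; clear; lia.
have c0 : 0 < 24 * C by rewrite mulr_gt0.
rewrite [leLHS](_ : _ = \sum_(j <- levels n) ((2 * (24 * C) ^+ 3)^-1 *
   ((theta / 2) ^+ (4 ^ n) * theta ^- (3 * n) / (n.+1%:R ^+ 2 * total ^+ 2)))); last first.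
  rewrite big_const_seq count_predT size_iota iter_addr_0 -[RHS]mulr_natr natrX.
  have -> : (2 / theta ^+ 3) ^+ n = 2 ^+ n / theta ^+ (3 * n) by rewrite expr_div_n -exprM.
  have t0 : theta ^+ (3 * n) != 0 by rewrite expf_neq0// gt_eqF.
  have x0 : (24 * C) ^+ 3 != 0 by rewrite expf_neq0// gt_eqF.
  have y0 : n.+1%:R ^+ 2 != 0 :> R by rewrite expf_neq0.
  have z0 : total ^+ 2 != 0 by rewrite expf_neq0// gt_eqF.
  move: (theta ^+ (3 * n)) t0 ((24 * C) ^+ 3) x0 (n.+1%:R ^+ 2) y0 (total ^+ 2) z0.
  move: (_ ^+ (4 ^ n)) (2 ^+ n) => p q t t0 x x0 y y0 z z0.
  by field; rewrite t0 x0 y0 z0.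
rewrite big_seq [leRHS]big_seq; apply: ler_sum => j jn.
have [j1 _ _] := levelsP n2 jn.
rewrite -(@level_value R a a_gt0 a_lt n j); last by rewrite (leq_trans _ j1)// leq_mul2r orbT.
set i := (j - 3 * n)%N; set D := _ * spike_mass a n j.
have D0 : 0 <= D by rewrite mulr_ge0 ?site_mass_ge0 ?spike_mass_ge0.
(* Rounding down loses at most a factor 2, as the argument is at least 1: [levels] ensures i >= n,
   and n was chosen with theta^n >= 12 C. *)
have mge : theta ^+ i / (24 * C) <= (m j)%:R.
  have ni : (n <= i)%N by rewrite /i; move: j1; clear; lia.
  pose x := theta ^+ i / (12 * C).
  have x1 : 1 <= x.
    rewrite ler_pdivlMr ?mulr_gt0// mul1r; apply: (le_trans nC).
    by apply: ler_weXn2l => //; exact: ltW.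
  have x0 : 0 <= x by exact: le_trans x1.
  have -> : theta ^+ i / (24 * C) = x / 2 by rewrite /x; field; rewrite gt_eqF.
  have /andP[_ m2] := truncn_itv x0.
  have m1 : 1 <= (m j)%:R :> R by rewrite ler1n truncn_gt0.
  have : x < (m j)%:R + 1 by rewrite natr1.
  by lra.
have ti : 0 < theta ^+ i by rewrite exprn_gt0.
have : (theta ^+ i / (24 * C)) ^+ 3 <= (m j)%:R ^+ 3.
  by rewrite lerXn2r ?nnegrE ?divr_ge0 ?(ltW ti) ?(ltW c0).
move/(ler_wpM2r (divr_ge0 D0 (ler0n R 2))); apply: le_trans.
rewrite expr_div_n -exprM (mulnC i) le_eqVlt; apply/orP; left; apply/eqP.
have x0 : (24 * C) ^+ 3 != 0 by rewrite expf_neq0// gt_eqF.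
by move: ((24 * C) ^+ 3) x0 => x x0; field; rewrite x0.
Qed.

Lemma SRT_fails (nu : probability (measurableTypeR R) R) (hh : R) :
  0 < hh -> ~ SRT a scale law nu hh.
Proof.
move=> hh0 srt; set k := srt_constant a nu * hh in srt.
have U0 B : (0 <= renewal_measure law B)%E.
  by apply: nneseries_ge0 => n _ _.
(* The inverse of 0 is 0, so for k <= 0 the quotient is nonpositive at every x > 0 and cannot tend
   to 1. For k > 0 it is at least 2 at arbitrarily large x. *)
have [k0|k0] := leP k 0.
  suff : (1 <= 0 :> \bar R)%E by rewrite lee_fin ler10.
  apply: (@cvge_to_le _ _ _ _ _ _ _ srt); near=> x.
  have x0 : 0 < x by near: x; apply: nbhs_pinfty_gt; exact: num_real.
  apply: mule_ge0_le0 => //; rewrite lee_fin invr_le0 mulr_le0_ge0//.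
  have A0 : 0 < scale x by apply: scale_gt0 => //; exact: ltW.
  by rewrite divr_ge0 ?(ltW x0) ?(ltW A0).
have [M [_ HM]] : \forall x \near +oo, (renewal_measure law `](x - hh)%R, x] *
    ((k * (scale x / x))^-1)%:E < 2%:E)%E.
  apply: (srt [set z | (z < 2%:E)%E]); apply: open_nbhs_nbhs; split.
    exact: open_ereal_lt_ereal.
  by rewrite /= lte_fin ltr1n.
have [c c0 [n0 Hc]] := potential_ge.
have [n n0n nB] := unbounded_ratio a_gt0 a_lt 2 (maxn n0 (Num.truncn M).+1) (divr_gt0 c0 k0).
have [S [N [uS]]] := Hc n (leq_trans (leq_maxl _ _) n0n).
set L := c * _ => SN.
have Mx : M < ((2 ^ (4 ^ n))%N%:Z)%:~R.
  rewrite -pmulrn natrX; apply: exp2_ge (leq_trans (leq_maxr _ _) n0n) _.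
  by rewrite ltnW// ltn_expl.
have := HM _ Mx; apply/negP; rewrite -leNgt.
have R1 := renewal_measure_ge uS mass_ge0 (fun i _ => mass_le i) (2 ^ (4 ^ n))%N%:Z N hh0.
set s := scale _ / _ in nB; rewrite -pmulrn -/s.
have p0 : 0 < (2 ^ (4 ^ n))%:R :> R by rewrite ltr0n expn_gt0.
have s0 : 0 < s by apply: divr_gt0 => //; exact: scale_gt0.
apply: (@le_trans _ _ (L%:E * ((k * s)^-1)%:E)%E).
  rewrite -EFinM lee_fin (le_trans nB)// le_eqVlt; apply/orP; left; apply/eqP.
  rewrite /L; move: (_ / _ ^+ 2) => q; field.
  by rewrite !gt_eqF.
apply: lee_wpmul2r; first by rewrite lee_fin invr_ge0 mulr_ge0// ltW.
by apply: le_trans R1; rewrite lee_fin.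
Unshelve. all: by end_near. Qed.

End renewal.

Unset Implicit Arguments.

Theorem proposition1p16 (R : realType) (alpha : R)
    (alpha_gt0 : 0 < alpha) (alpha_lt : alpha < 1 / 3) :
  exists F : probability (measurableTypeR R) R,
    exists (A : R -> R) (p q : R),
      (RV alpha A /\ standard_normalization alpha A) /\
      (0 < p /\ 0 < q) /\
      asymp_equiv (fun x : R => fine (F `]x, +oo[%classic)) (fun x => p / A x) /\
      asymp_equiv (fun x : R => fine (F `]-oo, (- x)]%classic)) (fun x => q / A x) /\
      is_an A (I1tilde A F) /\
      (forall eta : R, 0 < eta < 1 -> ~ is_an A (I2tilde A F eta)) /\
      (forall (nu : probability (measurableTypeR R) R) (h : R),
        walk_cvg_law F (fun n => inv_of A n%:R) nu ->
        admissible_span F h ->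
        ~ SRT alpha A F nu h).
Proof.
exists (example_law alpha_gt0 alpha_lt), (stable_scale alpha).
have Z0 : 0 < (total_weight alpha)^-1 by rewrite invr_gt0 total_gt0.
exists (total_weight alpha)^-1, (total_weight alpha)^-1.
split; first by split; [exact: RV_scale|exact: normalized_scale].
split; first by split.
split; first exact: law_right_tail_asymp.
split; first exact: law_left_tail_asymp.
split; first exact: I1tilde_an.
split; first by move=> eta /andP[eta0 _]; exact: I2tilde_not_an.
by move=> nu h _ [h0 _]; exact: SRT_fails.
Qed.
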